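(* Let $W=(V,B)$ be a non-degenerate formed space of Witt index $\omega\ge 2$ as described in the context, and let $1\le k\le \omega$. Let $\Gamma$ be the polar Grassmann graph of $W$ on singular $k$-subspaces. Then the following are equivalent: (i) $\Gamma$ is geodesic-transitive; (ii) $\Gamma$ is distance-regular; (iii) $k=1$ (the polar graph) or $k=\omega$ (the dual polar graph).
   Context: $V$ is a finite-dimensional vector space over $\mathbb{F}_q$ and $W=(V,B)$ is one of: a symplectic space of dimension $2\omega$ ($B$ alternating); an orthogonal space of dimension $2\omega+1$, of plus type of dimension $2\omega$, or of minus type of dimension $2\omega+2$ (non-degenerate quadratic form, $B$ its associated bilinear form); a unitary space of dimension $2\omega+1$ or $2\omega$ ($q$ a square, $B$ Hermitian). For $U\le V$, $U^\perp=\{v\in V: B(u,v)=0 \text{ for all } u\in U\}$. A subspace is singular if it is totally isotropic (totally singular for the quadratic form in the orthogonal case); the maximal singular subspaces have dimension $\omega$ (the Witt index). The polar Grassmann graph on singular $k$-subspaces has vertex set the singular $k$-subspaces of $W$; if $k=\omega$, two vertices $u,v$ are adjacent iff $\dim(u\cap v)=k-1$; if $k<\omega$, two distinct vertices $u,v$ are adjacent iff $u+v$ is a singular $(k+1)$-subspace. A geodesic of length $\ell$ is a vertex sequence $(v_0,\dots,v_\ell)$ with consecutive vertices adjacent and $d(v_0,v_\ell)=\ell$; $\Gamma$ is geodesic-transitive if $\mathrm{Aut}\,\Gamma$ is transitive on geodesics of each length. A connected graph of diameter $d$ is distance-regular if there are integers $b_i,c_i$ such that for any vertices $X,Y$ at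 distance $i$, exactly $c_i$ neighbours of $X$ are at distance $i-1$ from $Y$ and exactly $b_i$ are at distance $i+1$ from $Y$. *)

(* Defs.v *)
From HB Require Import structures.
From mathcomp Require Import all_boot all_order all_algebra all_fingroup.
Set Implicit Arguments. Unset Strict Implicit. Unset Printing Implicit Defensive.
Import GRing.Theory.
Local Open Scope ring_scope.

Definition form_val (F : fieldType) (n : nat) (M : 'M[F]_n) (sigma : F -> F)
  (u v : 'rV[F]_n) : F := (u *m M *m (map_mx sigma v)^T) 0 0.

(* Q(v) = v A v^T : every quadratic form on F^n has this shape *)
Definition quad_form (F : fieldType) (n : nat) (A : 'M[F]_n) (v : 'rV[F]_n) : F :=
  (v *m A *m v^T) 0 0.

Inductive formed_space (F : finFieldType) (n : nat) : Type :=
| Symplectic of 'M[F]_n            (* Gram matrix of an alternating form *)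
| Orthogonal of 'M[F]_n            (* A with Q(v) = v A v^T *)
| Unitary of (F -> F) & 'M[F]_n.   (* field involution sigma, Gram matrix *)

(* the bilinear / sesquilinear form B of W (for Orthogonal: the form
   associated with Q, B(u,v) = Q(u+v) - Q(u) - Q(v)) *)
Definition bform (F : finFieldType) n (W : formed_space F n) : 'rV[F]_n -> 'rV[F]_n -> F :=
  match W with
  | Symplectic M => form_val M id
  | Orthogonal A => form_val (A + A^T) id
  | Unitary s M => form_val M s
  end.

Definition formed_nondegenerate (F : finFieldType) n (W : formed_space F n) : Prop :=
  match W with
  | Symplectic M => [/\ M^T = - M, (forall i, M i i = 0) & M \in unitmx]
  | Orthogonal A =>
      forall v : 'rV[F]_n, v != 0 -> (forall u, bform W u v = 0) -> quad_form A v != 0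
  | Unitary s M =>
      [/\ [/\ (forall x y, s (x + y) = s x + s y), (forall x y, s (x * y) = s x * s y)
               & s 1 = 1],
          (forall x, s (s x) = x) /\ (exists x, s x != x),
          M^T = map_mx s M & M \in unitmx]
  end.

Definition fs_singular (F : finFieldType) n (W : formed_space F n) (U : 'M[F]_n) : bool :=
  match W with
  | Orthogonal A => [forall v : 'rV[F]_n, (v <= U)%MS ==> (quad_form A v == 0)]
  | _ => [forall u : 'rV[F]_n, forall v : 'rV[F]_n,
            ((u <= U)%MS && (v <= U)%MS) ==> (bform W u v == 0)]
  end.

Definition witt_index (F : finFieldType) n (W : formed_space F n) : nat :=
  \max_(U : 'M[F]_n | fs_singular W U) \rank U.

(* singular k-subspaces, each represented by its canonical matrix <<U>> *)
Definition polar_vpred (F : finFieldType) n (W : formed_space F n) (k : nat) :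
  pred 'M[F]_n := fun U => [&& (<<U>>%MS == U), \rank U == k & fs_singular W U].

Notation vert W k := {U | polar_vpred W k U}.

Definition polar_adj (F : finFieldType) n (W : formed_space F n) (k : nat) :
  rel (vert W k) := fun x y =>
  let U := val x in let U' := val y in
  if k == witt_index W then \rank (U :&: U')%MS == k.-1
  else [&& U != U', fs_singular W (U + U')%MS & \rank (U + U')%MS == k.+1].

Arguments polar_adj {F n} W k.

Section Graphs.
Variables (T : finType) (e : rel T).

Definition walkb (x y : T) (i : nat) : bool :=
  [exists t : i.-tuple T, path e x t && (last x t == y)].

Definition distb (x y : T) (i : nat) : bool :=
  walkb x y i && [forall j : 'I_i, ~~ walkb x y j].

Definition graph_connected : Prop := forall x y : T, exists i, walkb x y i.

Definition geodesic (x : T) (p : seq T) : bool :=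
  path e x p && distb x (last x p) (size p).

Definition is_aut (g : {perm T}) : Prop := forall x y, e (g x) (g y) = e x y.

Definition geodesic_transitive : Prop :=
  forall (x y : T) (p q : seq T), size p = size q ->
    geodesic x p -> geodesic y q ->
    exists g : {perm T}, [/\ is_aut g, g x = y & map g p = q].

Definition distance_regular : Prop :=
  graph_connected /\
  exists b c : nat -> nat, forall (x y : T) (i : nat), distb x y i ->
    ((0 < i)%N -> #|[set z | e x z && distb y z i.-1]| = c i) /\
    #|[set z | e x z && distb y z i.+1]| = b i.

End Graphs.

(* Main.v *)
(* A hyperbolic frame is a family of singular vectors e_i, f_i with
   B(e_i, f_j) = delta_ij and all other products zero.  Reflections and Siegel
   transformations carry any frame to any other frame of the same length, one
   pair (e_i, f_i) at a time, so no general Witt theorem is needed.  For k = 1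
   and for k = omega each geodesic can be read off a frame: it is
   <e_0>, <e_1>, <f_0> in the polar graph (which has diameter 2), and
   v_i = <f_j, e_l : j < i <= l> in the dual polar graph.  Hence isometries are
   already transitive on geodesics.

   For 1 < k < omega the number c_2 is not well defined.  If U = <A, e> and
   U' = <A, f> with dim A = k-1, (e, f) a hyperbolic pair perpendicular to A, and
   (e', f') another one perpendicular to A, e and f, then <A, e'> and <A, f'> are
   two common neighbours.  If U = <A, a, e> and U' = <A, b, f> with dim A = k-2
   and all products zero except B(e, f), then <A, a, b> is the only one. *)
Require Import Defs.
From HB Require Import structures.
From mathcomp Require Import all_boot all_order all_algebra all_fingroup.
From mathcomp Require Import ring zify.
Local Open Scope nat_scope.
Set Implicit Arguments. Unset Strict Implicit. Unset Printing Implicit Defensive.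
Import GRing.Theory.

(** * Distances and automorphisms of finite graphs *)

(** The three kinds of space are treated at once, in every characteristic, through the record
    [polar_form]. Two obstacles dictate its axioms. In characteristic 2 the form does not determine
    the quadratic form, so division by 2 is replaced by an additive map [t]: polarization reads
    [q (u + v) = q u + q v + t (B u v)], and [pfq_tr] puts every value of [q] in the image of [t],
    which is exactly what allows a vector to be made singular by adding a multiple of another one.
    Moreover [B] may have a radical in the orthogonal case; hence non-degeneracy is demanded of
    singular vectors only, and dual vectors are built only for independent families with singular
    span. On the graph side, (i) and (ii) both imply the weaker [constant_sphere_cards], and this
    alone is refuted for [1 < k < omega]. *)

Section GraphDistance.
Variables (T : finType) (e : rel T).

Lemma walkbP (x y : T) i :
  reflect (exists p, [/\ size p = i, path e x p & last x p = y]) (walkb e x y i).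
Proof.
apply: (iffP existsP) => [[t /andP[ept /eqP lt]]|[p [<- ep lp]]].
  by exists t; rewrite size_tuple.
by exists (in_tuple p); rewrite ep lp eqxx.
Qed.

Lemma distbP (x y : T) i :
  reflect (walkb e x y i /\ forall j, j < i -> ~~ walkb e x y j) (distb e x y i).
Proof.
apply: (iffP andP) => [[-> /forallP H]|[-> H]]; split => //.
  by move=> j ltji; apply: (H (Ordinal ltji)).
by apply/forallP => j; apply: H.
Qed.

Lemma walkb0 (x y : T) : walkb e x y 0 = (x == y).
Proof.
apply/walkbP/eqP => [[p [/size0nil -> _ /= <-]]|->] //.
by exists [::].
Qed.

Lemma walkb1 (x y : T) : walkb e x y 1 = e x y.
Proof.
apply/walkbP/idP => [[[|z [|? ?]] [] //= _ /andP[ezx _] <-]|exy] //.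
by exists [:: y]; rewrite /= exy.
Qed.

Lemma walkb_cons (x y z : T) i : e x y -> walkb e y z i -> walkb e x z i.+1.
Proof.
move=> exy /walkbP[p [sp ep lp]]; apply/walkbP; exists (y :: p).
by rewrite /= sp exy ep lp.
Qed.

Lemma walkb_rcons (x y z : T) i : walkb e x y i -> e y z -> walkb e x z i.+1.
Proof.
move=> /walkbP[p [sp ep lp]] eyz; apply/walkbP; exists (rcons p z).
by rewrite size_rcons sp rcons_path ep lp eyz last_rcons.
Qed.

Lemma distb1 (x y : T) : distb e x y 1 = (x != y) && e x y.
Proof.
rewrite -walkb0 -walkb1; apply/distbP/andP => [[w1 /(_ 0 isT) w0]|[w0 w1]] //.
by split => // -[].
Qed.

Lemma distb2 (x y z : T) :
  x != z -> ~~ e x z -> e x y -> e y z -> distb e x z 2.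
Proof.
move=> nxz nexz exy eyz; apply/distbP; split.
  by apply: walkb_cons exy _; rewrite walkb1.
by case=> [|[|]] //; rewrite ?walkb0 ?walkb1.
Qed.

Lemma geodesic_of_distb (x y : T) i :
  distb e x y i -> exists p, [/\ size p = i, geodesic e x p & last x p = y].
Proof.
move=> dxy; have /distbP[/walkbP[p [sp ep lp]] _] := dxy.
by exists p; rewrite /geodesic ep lp sp dxy.
Qed.

(** This allows induction on a geodesic from its far end: a shorter walk to the end of the prefix
    could be prolonged to [z]. *)
Lemma geodesic_rcons (x z : T) p : geodesic e x (rcons p z) ->
  [/\ geodesic e x p, e (last x p) z & forall j, j <= size p -> ~~ walkb e x z j].
Proof.
rewrite /geodesic rcons_path last_rcons size_rcons => /andP[/andP[ep elz]].
move=> /distbP[_ nw]; rewrite ep elz; split => //.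
apply/distbP; split; first by apply/walkbP; exists p.
move=> j ltj; apply/negP => /walkb_rcons/(_ elz).
by apply/negP/nw.
Qed.

Lemma aut_walkb (g : {perm T}) x y i :
  is_aut e g -> walkb e (g x) (g y) i = walkb e x y i.
Proof.
move=> autg; elim: i x => [|i IHi] x.
  by rewrite !walkb0 (inj_eq perm_inj).
have walkbS u v : walkb e u v i.+1 = [exists z, e u z && walkb e z v i].
  apply/walkbP/existsP => [[[|z p] [] //= [sp] /andP[euz ep] lp]|[z /andP[euz]]].
    by exists z; rewrite euz; apply/walkbP; exists p.
  by move/(walkb_cons euz)/walkbP.
rewrite !walkbS; apply/existsP/existsP => -[z /andP[exz w]].
  exists ((g^-1)%g z); rewrite -IHi -autg permKV exz //.
by exists (g z); rewrite autg exz IHi.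
Qed.

Lemma aut_distb (g : {perm T}) x y i :
  is_aut e g -> distb e (g x) (g y) i = distb e x y i.
Proof.
move=> autg; rewrite /distb aut_walkb //; congr (_ && _).
by apply: eq_forallb => j; rewrite aut_walkb.
Qed.

Definition sphere_card (x y : T) (j : nat) : nat :=
  #|[set z | e x z && distb e y z j]|.

(** Distance-regularity stripped of connectedness and of the functions [b] and [c]: the last clause
    restricts [j] to the two values that define the intersection numbers. *)
Definition constant_sphere_cards : Prop :=
  forall x y x' y' i j, distb e x y i -> distb e x' y' i ->
    j = i.+1 \/ (0 < i /\ j = i.-1) -> sphere_card x y j = sphere_card x' y' j.

Lemma aut_sphere_card (g : {perm T}) x y j :
  is_aut e g -> sphere_card (g x) (g y) j = sphere_card x y j.
Proof.
move=> autg; rewrite /sphere_card -[RHS](card_imset _ (@perm_inj _ g)).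
apply: eq_card => z; rewrite inE; apply/idP/imsetP => [H|[w]].
  exists ((g^-1)%g z); last by rewrite permKV.
  by rewrite inE -autg -(aut_distb _ _ _ autg) permKV.
by rewrite inE => H ->; rewrite autg aut_distb.
Qed.

Lemma geodesic_transitive_constant :
  geodesic_transitive e -> constant_sphere_cards.
Proof.
move=> gt x y x' y' i j /geodesic_of_distb[p [sp gp lp]].
move=> /geodesic_of_distb[q [sq gq lq]] _.
have [|g [autg gx gpq]] := gt x x' p q _ gp gq; first by rewrite sp sq.
rewrite -(aut_sphere_card x y j autg) gx; congr sphere_card.
by rewrite -lp -lq -gpq -gx last_map.
Qed.

Lemma distance_regular_constant :
  distance_regular e -> constant_sphere_cards.
Proof.
move=> [_ [b [c bc]]] x y x' y' i j dxy dxy' [->|[i_gt0 ->]].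
  by rewrite /sphere_card (bc _ _ _ dxy).2 (bc _ _ _ dxy').2.
by rewrite /sphere_card (bc _ _ _ dxy).1 // (bc _ _ _ dxy').1.
Qed.

Lemma constant_distance_regular :
  graph_connected e -> constant_sphere_cards -> distance_regular e.
Proof.
move=> conn cst; split=> //.
(* The intersection numbers are read off an arbitrary pair at distance [i]; the default 0 is met
   only when there is no such pair. *)
pose N d i := if [pick u : T * T | distb e u.1 u.2 i] is Some u
              then sphere_card u.1 u.2 (if d then i.+1 else i.-1) else 0.
have NE (d : bool) x y i : distb e x y i -> d \/ 0 < i ->
    sphere_card x y (if d then i.+1 else i.-1) = N d i.
  move=> dxy di; rewrite /N; case: pickP => [u du|/(_ (x, y))]; last by rewrite dxy.
  by apply: cst dxy du _; case: d di => [_|[|i_gt0]] //; [left | right].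
exists (N true), (N false) => x y i dxy; split=> [i_gt0|].
  by apply: (NE false) => //; right.
by apply: (NE true) => //; left.
Qed.

End GraphDistance.

(** * Polar forms, isometries and hyperbolic frames *)

Section PolarFormRecord.
Local Open Scope ring_scope.

(* Common axioms of the three kinds of formed space, [pfs] being the involution
   and [pfB v u = pfe * pfs (pfB u v)]:
   - symplectic: [pfe = -1], [pfq = 0], [pft = 0];
   - orthogonal: [pfe = 1], [pfq] is the quadratic form, [pft = id];
   - unitary: [pfe = 1], [pfq u = pfB u u], [pft] is the trace [a + pfs a]. *)
Record polar_form (F : finFieldType) (n : nat) := PolarForm {
  pfB : 'rV[F]_n -> 'rV[F]_n -> F;
  pfs : {rmorphism F -> F};
  pfe : F;
  pfq : 'rV[F]_n -> F;
  pft : F -> F;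
  pfBDl : forall u v w, pfB (u + v) w = pfB u w + pfB v w;
  pfBZl : forall a u v, pfB (a *: u) v = a * pfB u v;
  pfBC : forall u v, pfB v u = pfe * pfs (pfB u v);
  pfsK : forall a, pfs (pfs a) = a;
  pfe2 : pfe * pfe = 1;
  pfse : pfs pfe = pfe;
  pfqD : forall u v, pfq (u + v) = pfq u + pfq v + pft (pfB u v);
  pfqZ : forall a u, pfq (a *: u) = a * pfs a * pfq u;
  pftD : forall a b, pft (a + b) = pft a + pft b;
  pfts : forall a, pft (pfe * pfs a) = pft a;
  pftZ : forall a b, pfs a = a -> pft (a * b) = a * pft b;
  pfq_tr : forall u, exists c, pft c = pfq u;
  pfq_iso : forall u, pfq u = 0 -> pfB u u = 0;
  pf_nondeg : forall u, u != 0 -> pfq u = 0 -> exists v, pfB u v != 0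
}.

End PolarFormRecord.

Section PolarForm.
Local Open Scope ring_scope.
Variables (F : finFieldType) (n : nat) (P : polar_form F n).
Local Notation B := (pfB P).
Local Notation q := (pfq P).
Local Notation t := (pft P).
Local Notation s := (pfs P).
Local Notation eps := (pfe P).
Implicit Types (u v w x y z : 'rV[F]_n).

Lemma pfB0l v : B 0 v = 0.
Proof. by rewrite -(scale0r (0 : 'rV_n)) pfBZl mul0r. Qed.

Lemma pfBNl u v : B (- u) v = - B u v.
Proof. by rewrite -scaleN1r pfBZl mulN1r. Qed.

Lemma pfBDr u v w : B u (v + w) = B u v + B u w.
Proof. by rewrite !(pfBC P _ u) pfBDl rmorphD mulrDr. Qed.

Lemma pfBZr a u v : B u (a *: v) = s a * B u v.
Proof. by rewrite !(pfBC P _ u) pfBZl rmorphM mulrCA. Qed.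

Lemma pfB0r v : B v 0 = 0.
Proof. by rewrite pfBC pfB0l rmorph0 mulr0. Qed.

Lemma pfBNr u v : B u (- v) = - B u v.
Proof. by rewrite !(pfBC P _ u) pfBNl rmorphN mulrN. Qed.

Definition pfBE := (pfBDl, pfBDr, pfBZl, pfBZr, pfBNl, pfBNr, pfB0l, pfB0r).

Lemma pfe_neq0 : eps != 0.
Proof. by apply/eqP => e0; have /eqP := pfe2 P; rewrite e0 mul0r eq_sym oner_eq0. Qed.

Lemma pfB_eq0C u v : (B u v == 0) = (B v u == 0).
Proof. by rewrite (pfBC P v u) mulf_eq0 (negPf pfe_neq0) fmorph_eq0. Qed.

Lemma pfB0C u v : B u v = 0 -> B v u = 0.
Proof. by move/eqP; rewrite pfB_eq0C => /eqP. Qed.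

Lemma pft0 : t 0 = 0.
Proof. by apply/(@addrI _ (t 0)); rewrite -pftD !addr0. Qed.

Lemma pftN a : t (- a) = - t a.
Proof. by apply/eqP; rewrite -addr_eq0 -pftD addNr pft0. Qed.

Lemma pfq0 : q 0 = 0.
Proof. by rewrite -(scale0r (0 : 'rV_n)) pfqZ !mul0r. Qed.

Lemma pfqD0 u v : q u = 0 -> q v = 0 -> B u v = 0 -> q (u + v) = 0.
Proof. by move=> qu qv Buv; rewrite pfqD qu qv Buv pft0 !addr0. Qed.

Lemma pfqZ0 a u : q u = 0 -> q (a *: u) = 0.
Proof. by move=> qu; rewrite pfqZ qu mulr0. Qed.

Lemma pfqN u : q (- u) = q u.
Proof. by rewrite -scaleN1r pfqZ rmorphN1 mulrNN !mul1r. Qed.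

(** * Isometries: reflections and Siegel transformations *)

Definition isometry (g : 'M[F]_n) : Prop :=
  (forall u v, B (u *m g) (v *m g) = B u v) /\ (forall u, q (u *m g) = q u).

Lemma isometry1 : isometry 1%:M.
Proof. by split=> *; rewrite !mulmx1. Qed.

Lemma isometryM g h : isometry g -> isometry h -> isometry (g *m h).
Proof.
by move=> [gB gq] [hB hq]; split=> *; rewrite !mulmxA ?hB ?gB ?hq ?gq.
Qed.

Lemma isometry_unit g : isometry g -> g \in unitmx.
Proof.
move=> [gB gq]; rewrite -row_free_unit -kermx_eq0.
apply/negPn/negP => /rowV0Pn[u /sub_kermxP ug0 u0].
have [|v] := pf_nondeg u0 (p := P); first by rewrite -gq ug0 pfq0.
by rewrite -gB ug0 pfB0l eqxx.
Qed.

Lemma linear_mx (f : 'rV[F]_n -> 'rV[F]_n) :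
  (forall a u v, f (a *: u + v) = a *: f u + f v) ->
  exists g : 'M[F]_n, forall u, u *m g = f u.
Proof.
move=> lin_f.
pose fL := GRing.isLinear.Build F 'rV[F]_n 'rV[F]_n _ f lin_f.
pose fl : {linear 'rV[F]_n -> 'rV[F]_n} := HB.pack f fL.
by exists (lin1_mx fl) => u; rewrite mul_rV_lin1.
Qed.

(* The map [u + (B u w / B x y) w] with [w = x - y]: a reflection, a symplectic
   transvection or a unitary quasi-reflection. *)
Lemma reflection_exists x y :
  q x = 0 -> q y = 0 -> B x y != 0 ->
  exists g, [/\ isometry g, x *m g = y & forall z, B z x = B z y -> z *m g = z].
Proof.
move=> qx qy c0; set c := B x y in c0.
have [w wE] : exists w, w = x - y by exists (x - y).
have Bxx : B x x = 0 by apply: pfq_iso.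
have Byy : B y y = 0 by apply: pfq_iso.
have Byx : B y x = eps * s c by rewrite pfBC.
have Bww : B w w = - c - eps * s c.
  by rewrite wE !pfBE Bxx Byy Byx -/c; ring.
have qw : q w = - t c by rewrite wE pfqD qx pfqN qy pfBNr pftN -/c !add0r.
have sc0 : s c != 0 by rewrite fmorph_eq0.
have [|g gE] := linear_mx (f := fun u => u + (c^-1 * B u w) *: w).
  move=> a u v; rewrite !pfBE /= mulrDr scalerDl scalerDr !scalerA.
  by rewrite addrACA; congr (_ + _ *: _ + _); ring.
exists g; split.
- split=> [u v|u]; rewrite !gE.
    rewrite !(pfBDl, pfBDr, pfBZl, pfBZr) Bww (pfBC P v w) !rmorphM fmorphV.
    have ->: s (B v w) = eps * B w v by rewrite (pfBC P v w) mulrA pfe2 mul1r.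
    set a := B u w; set b := B w v; field.
    by rewrite sc0 c0.
  rewrite pfqD pfqZ qw pfBZr rmorphM fmorphV.
  (* [N] is the norm of [b / c]. It is fixed by the involution, so [pftZ] takes it out of the trace
     and [t (N * c)] cancels [N * q w]. *)
  set b := B u w; set N := c^-1 * b * ((s c)^-1 * s b).
  have sN : s N = N by rewrite /N !rmorphM !fmorphV !pfsK; ring.
  have ->: (s c)^-1 * s b * b = N * c.
    by rewrite /N; field; rewrite sc0 c0.
  by rewrite pftZ //; ring.
- rewrite gE; have ->: B x w = - c by rewrite wE !pfBE Bxx sub0r.
  by rewrite mulrN mulVf // wE scaleN1r opprB addrC subrK.
- move=> z Bz; rewrite gE wE !pfBE Bz subrr mulr0 scale0r addr0 //.
Qed.

(* A Siegel (Eichler) transformation with centre [z]. *)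
Lemma siegel_exists z x y :
  q z = 0 -> q x = 0 -> q y = 0 -> B z x = 1 -> B z y = 1 ->
  exists g, [/\ isometry g, z *m g = z, x *m g = y &
    forall u, B u z = 0 -> B u x = B u y -> u *m g = u].
Proof.
move=> qz qx qy Bzx Bzy.
have [w wE] : exists w, w = y - x by exists (y - x).
have [m mE] : exists m, m = B x y by exists (B x y).
have Bzz : B z z = 0 by apply: pfq_iso.
have Bxx : B x x = 0 by apply: pfq_iso.
have Byy : B y y = 0 by apply: pfq_iso.
have Byx : B y x = eps * s m by rewrite mE pfBC.
have Bzw : B z w = 0 by rewrite wE !pfBE Bzx Bzy subrr.
have Bwz : B w z = 0 by apply: pfB0C.
have Bww : B w w = - m - eps * s m.
  by rewrite wE !pfBE Bxx Byy Byx -mE; ring.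
have Bxw : B x w = m by rewrite wE !pfBE Bxx subr0.
have Bxz : B x z = eps by rewrite pfBC Bzx rmorph1 mulr1.
have qw : q w = - t m.
  by rewrite wE pfqD qy pfqN qx pfBNr pftN Byx pfts !add0r.
pose b u := eps * B u z.
(* Since [t m = - q w], the scalar [m] does the work of [- q w] in the orthogonal case and of an
   element with that trace in the unitary case, without dividing by 2. *)
have [|g gE] := linear_mx (f := fun u => u + b u *: w + (m * b u - B u w) *: z).
  move=> a u v; rewrite /b !pfBE !scalerDr !scalerA.
  rewrite [RHS]addrACA [X in _ = X + _]addrACA -!scalerDl.
  by congr (_ + _ *: _ + _ *: _); ring.
exists g; split.
- split=> [u v|u]; rewrite !gE.
    rewrite !(pfBDl, pfBDr, pfBZl, pfBZr) Bww Bwz Bzw Bzz /b.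
    rewrite (pfBC P v w) (pfBC P v z) !(rmorphM, rmorphB, pfse).
    transitivity (B u v + (eps * eps - 1) *
        (B u z * s (B v w) - eps * s m * s (B v z) * B u z)); first by ring.
    by rewrite pfe2 subrr mul0r addr0.
  rewrite !(pfqD, pfqZ) !(pfBDl, pfBZl, pfBZr) qz qw Bwz.
  have ->: B u z = eps * b u by rewrite /b mulrA pfe2 mul1r.
  set c := B u w; set d := b u; set N := d * s d.
  have sN : s N = N by rewrite /N rmorphM pfsK mulrC.
  have ->: s (m * d - c) * (eps * d) + d * (s (m * d - c) * 0)
      = eps * s (N * m) - eps * s (s d * c).
    by rewrite !(rmorphB, rmorphM, pfsK) /N; ring.
  by rewrite pftD pftN !pfts (pftZ m sN); ring.
- by rewrite gE /b Bzz Bzw mulr0 mulr0 subr0 !scale0r !addr0.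
- rewrite gE /b Bxz Bxw pfe2 mulr1 subrr scale1r scale0r addr0 wE.
  by rewrite addrC subrK.
- move=> u Buz Bu; rewrite gE /b Buz wE !pfBE Bu subrr !mulr0 subr0.
  by rewrite !scale0r !addr0.
Qed.

(* Two reflections through a singular [h] which is perpendicular to neither
   [x] nor [y]; [x'] and [y'] only serve to construct [h]. *)
Lemma singular_move x x' y y' :
  q x = 0 -> q y = 0 -> q x' = 0 -> q y' = 0 -> B x x' = 1 -> B y y' = 1 ->
  exists g, [/\ isometry g, x *m g = y & forall z,
    B z x = 0 -> B z y = 0 -> B z x' = 0 -> B z y' = 0 -> z *m g = z].
Proof.
move=> qx qy qx' qy' Bxx' Byy'.
have [Bxy|nBxy] := eqVneq (B x y) 0; last first.
  have [g [isog gx gz]] := reflection_exists qx qy nBxy.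
  by exists g; split=> // z zx zy _ _; apply: gz; rewrite zx zy.
have via h : q h = 0 -> B x h != 0 -> B y h != 0 ->
    (forall z, B z x = 0 -> B z y = 0 -> B z x' = 0 -> B z y' = 0 -> B z h = 0) ->
    exists g, [/\ isometry g, x *m g = y & forall z,
      B z x = 0 -> B z y = 0 -> B z x' = 0 -> B z y' = 0 -> z *m g = z].
  move=> qh nBxh nByh hz; rewrite pfB_eq0C in nByh.
  have [g1 [isog1 g1x g1z]] := reflection_exists qx qh nBxh.
  have [g2 [isog2 g2x g2z]] := reflection_exists qh qy nByh.
  exists (g1 *m g2); split; first exact: isometryM.
    by rewrite mulmxA g1x.
  move=> z zx zy zx' zy'; have zh := hz z zx zy zx' zy'.
  by rewrite mulmxA g1z ?g2z ?zx ?zh ?zy.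
have [Byx'|nByx'] := eqVneq (B y x') 0; last first.
  by apply: (via x') => //; rewrite Bxx' oner_neq0.
have [Bxy'|nBxy'] := eqVneq (B x y') 0; last first.
  by apply: (via y') => //; rewrite Byy' oner_neq0.
have Bxx : B x x = 0 by apply: pfq_iso.
(* Now [x] is perpendicular to [y] and [y'], and [y] to [x']. So [x' + y'] pairs to 1 with both [x]
   and [y]; the multiple of [x] does not change this and cancels [q (x' + y') = t (B x' y')]. *)
apply: (via (x' + y' + - (eps * s (B x' y')) *: x)).
- rewrite !pfqD qx' qy' pfqZ qx mulr0 add0r addr0 add0r -pftD.
  rewrite !(pfBZr, pfBDl) (pfBC P x x') (pfBC P x y') Bxx' Bxy'.
  rewrite !(rmorphN, rmorphM, rmorph0, rmorph1, pfsK, pfse).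
  by rewrite -[RHS]pft0; congr t; have e2 := pfe2 P; ring: e2.
- by rewrite !pfBE Bxx' Bxy' Bxx mulr0 !addr0 oner_neq0.
- by rewrite !pfBE Byx' Byy' (pfB0C Bxy) mulr0 add0r addr0 oner_neq0.
- by move=> z zx zy zx' zy'; rewrite !pfBE zx' zy' zx mulr0 !addr0.
Qed.

(** Once [x] is sent to [y], the image of [x'] and the vector [y'] both pair to 1 with [y], so a
    Siegel transformation centred at [y] matches them and leaves [y] in place. *)
Lemma hyperbolic_move x x' y y' :
  q x = 0 -> q y = 0 -> q x' = 0 -> q y' = 0 -> B x x' = 1 -> B y y' = 1 ->
  exists g, [/\ isometry g, x *m g = y, x' *m g = y' & forall z,
    B z x = 0 -> B z y = 0 -> B z x' = 0 -> B z y' = 0 -> z *m g = z].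
Proof.
move=> qx qy qx' qy' Bxx' Byy'.
have [g1 [isog1 g1x g1z]] := singular_move qx qy qx' qy' Bxx' Byy'.
have [B1 q1] := isog1.
have [||g2 [isog2 g2y g2x' g2z]] := @siegel_exists y (x' *m g1) y' qy _ qy' _ Byy'.
- by rewrite q1.
- by rewrite -g1x B1.
exists (g1 *m g2); split; first exact: isometryM.
- by rewrite mulmxA g1x.
- by rewrite mulmxA.
move=> z zx zy zx' zy'; have zg1 := g1z z zx zy zx' zy'.
by rewrite mulmxA zg1 g2z // zy' -{1}zg1 B1.
Qed.

(* [e 0, ..., e (m-1)] and [f 0, ..., f (l-1)]; [f] may be shorter than [e]. *)
Record hyp_frame (m l : nat) (e f : nat -> 'rV[F]_n) : Prop := HypFrame {
  hf_qe : forall i, (i < m)%N -> q (e i) = 0;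
  hf_qf : forall i, (i < l)%N -> q (f i) = 0;
  hf_ee : forall i j, (i < m)%N -> (j < m)%N -> B (e i) (e j) = 0;
  hf_ff : forall i j, (i < l)%N -> (j < l)%N -> B (f i) (f j) = 0;
  hf_ef : forall i j, (i < m)%N -> (j < l)%N -> B (e i) (f j) = (i == j)%:R
}.

Lemma hyp_frame_sub m l m' l' e f :
  (m' <= m)%N -> (l' <= l)%N -> hyp_frame m l e f -> hyp_frame m' l' e f.
Proof.
move=> lem lel [qe qf ee ff ef].
have em i : (i < m')%N -> (i < m)%N by move/leq_trans; apply.
have fl i : (i < l')%N -> (i < l)%N by move/leq_trans; apply.
by split=> *; rewrite ?(qe, qf, ee, ff, ef) ?em ?fl.
Qed.

(** The isometry that corrects the last pair fixes every vector perpendicular to both versions of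
    that pair, hence all pairs already matched. *)
Lemma hyp_frame_conj m e f e' f' :
  hyp_frame m m e f -> hyp_frame m m e' f' ->
  exists g, isometry g /\ forall i, (i < m)%N -> e i *m g = e' i /\ f i *m g = f' i.
Proof.
elim: m => [|m IHm] fr fr'.
  by exists 1%:M; split=> //; apply: isometry1.
have lem := leqnSn m.
have [g [isog gef]] := IHm (hyp_frame_sub lem lem fr) (hyp_frame_sub lem lem fr').
have [Bg qg] := isog.
have [||||||h [isoh he hf hz]] :=
  @hyperbolic_move (e m *m g) (f m *m g) (e' m) (f' m).
- by rewrite qg (hf_qe fr).
- by rewrite (hf_qe fr').
- by rewrite qg (hf_qf fr).
- by rewrite (hf_qf fr').
- by rewrite Bg (hf_ef fr) // eqxx.
- by rewrite (hf_ef fr') // eqxx.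
exists (g *m h); split=> [|i]; first exact: isometryM.
rewrite ltnS leq_eqVlt => /predU1P[->|ltim]; first by rewrite !mulmxA.
have [ei fi] := gef i ltim; have ltim1 := ltnW ltim.
have [nim nmi] : (i == m) = false /\ (m == i) = false.
  by rewrite [m == i]eq_sym ltn_eqF.
rewrite !mulmxA ei fi !hz //.
- by rewrite -fi Bg; apply: pfB0C; rewrite (hf_ef fr) // nmi.
- by apply: pfB0C; rewrite (hf_ef fr') // nmi.
- by rewrite -fi Bg (hf_ff fr).
- by rewrite (hf_ff fr').
- by rewrite -ei Bg (hf_ee fr).
- by rewrite (hf_ee fr').
- by rewrite -ei Bg (hf_ef fr) // nim.
- by rewrite (hf_ef fr') // nim.
Qed.

(** * Spans, hyperplanes and singular subspaces *)

Definition span (m : nat) (a : nat -> 'rV[F]_n) : 'M[F]_(m, n) :=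
  \matrix_(i < m) a i.

Lemma span_mul m a (g : 'M_n) : span m a *m g = span m (fun i => a i *m g).
Proof. by apply/row_matrixP => i; rewrite row_mul !rowK. Qed.

Lemma eq_span m a b : (forall i, (i < m)%N -> a i = b i) -> span m a = span m b.
Proof. by move=> eab; apply/row_matrixP => i; rewrite !rowK eab. Qed.

Lemma span_subP m p a (U : 'M_(p, n)) :
  reflect (forall i, (i < m)%N -> (a i <= U)%MS) (span m a <= U)%MS.
Proof.
apply: (iffP row_subP) => [H i ltim|H i]; last by rewrite rowK H.
by have := H (Ordinal ltim); rewrite rowK.
Qed.

Lemma mem_span m a i : (i < m)%N -> (a i <= span m a)%MS.
Proof. by move: i; apply/span_subP. Qed.

(** Linearity of [B] on the left makes this a kernel, so that the rank calculus of subspaces applies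
    to perpendicularity. *)
Definition perpmx x : 'M[F]_n := kermx (\col_i B (delta_mx 0 i) x).

Lemma pfB_col u x : B u x = (u *m \col_i B (delta_mx 0 i) x) 0 0.
Proof.
rewrite mxE [in LHS](row_sum_delta u).
under [RHS]eq_bigr do rewrite mxE -pfBZl.
by elim/big_rec2: _ => [|i y1 y2 _ <-]; rewrite ?pfB0l ?pfBDl.
Qed.

Lemma perpmxP u x : reflect (B u x = 0) (u <= perpmx x)%MS.
Proof.
rewrite pfB_col; apply: (iffP sub_kermxP) => [->|H]; first by rewrite mxE.
by apply/matrixP => i j; rewrite !ord1 H mxE.
Qed.

Lemma rank_perpmx m (U : 'M_(m, n)) x : (\rank U <= (\rank (U :&: perpmx x)).+1)%N.
Proof.
rewrite -(mxrank_mul_ker U (\col_i B (delta_mx 0 i) x)) addnC.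
by apply: leq_trans (leq_add (leqnn _) (rank_leq_col _)) _; rewrite addn1.
Qed.

(** One predicate for all kinds: the condition on [q] is void in the symplectic case and part of the
    one on [B] in the unitary case, while in the orthogonal case it implies the one on [B] by
    polarization. *)
Definition psing m (U : 'M[F]_(m, n)) : Prop :=
  forall u v, (u <= U)%MS -> (v <= U)%MS -> q u = 0 /\ B u v = 0.

Lemma psingS m p (U : 'M_(m, n)) (V : 'M_(p, n)) :
  (U <= V)%MS -> psing V -> psing U.
Proof. by move=> sUV sV u v uU vU; apply: sV; apply: submx_trans sUV. Qed.

Lemma psing_mul m (U : 'M_(m, n)) g : isometry g -> psing U -> psing (U *m g).
Proof.
move=> [Bg qg] sU u v /submxP[a ->] /submxP[b ->]; rewrite !mulmxA qg Bg.
by apply: sU; apply: submxMl.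
Qed.

Lemma psing_adds m p (U : 'M_(m, n)) (V : 'M_(p, n)) :
  psing U -> psing V -> (forall u v, (u <= U)%MS -> (v <= V)%MS -> B u v = 0) ->
  psing (U + V)%MS.
Proof.
move=> sU sV sUV u v /sub_addsmxP[[a b] -> /=] /sub_addsmxP[[c d] -> /=].
have [U1 U2] : (a *m U <= U)%MS /\ (c *m U <= U)%MS by rewrite !submxMl.
have [V1 V2] : (b *m V <= V)%MS /\ (d *m V <= V)%MS by rewrite !submxMl.
have [qa Bac] := sU _ _ U1 U2; have [qb Bbd] := sV _ _ V1 V2.
split; first by apply: pfqD0 => //; apply: sUV.
by rewrite !pfBE Bac Bbd (sUV _ _ U1 V2) (pfB0C (sUV _ _ U2 V1)) !addr0.
Qed.

Lemma psing_vec v : q v = 0 -> psing v.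
Proof.
move=> qv x y /sub_rVP[a ->] /sub_rVP[b ->].
by rewrite pfqZ0 // !pfBE pfq_iso ?mulr0.
Qed.

Lemma psing_span m a :
  (forall i, (i < m)%N -> q (a i) = 0) ->
  (forall i j, (i < m)%N -> (j < m)%N -> B (a i) (a j) = 0) -> psing (span m a).
Proof.
elim: m => [|m IHm] qa Ba.
  by move=> u v /submxP[x ->] _; rewrite [x]thinmx0 mul0mx pfq0 pfB0l.
apply: (@psingS _ _ _ (span m a + a m)%MS).
  apply/span_subP => i; rewrite ltnS leq_eqVlt => /predU1P[->|ltim].
    exact: addsmxSr.
  by apply: submx_trans (addsmxSl _ _); apply: mem_span.
apply: psing_adds.
- by apply: IHm => i *; [apply: qa|apply: Ba]; apply: ltnW.
- exact/psing_vec/qa.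
move=> u v uU /sub_rVP[c ->]; rewrite pfBZr.
suff /perpmxP -> : (u <= perpmx (a m))%MS by rewrite mulr0.
apply: submx_trans uU _; apply/span_subP => i ltim; apply/perpmxP.
by apply: Ba => //; apply: ltnW.
Qed.

(** Pairing a linear relation with [b j] isolates its coefficient at [j]. *)
Lemma row_free_dual m a b :
  (forall i j, (i < m)%N -> (j < m)%N -> i != j -> B (a i) (b j) = 0) ->
  (forall i, (i < m)%N -> B (a i) (b i) != 0) -> row_free (span m a).
Proof.
move=> Bij Bii; rewrite -kermx_eq0; apply/negPn/negP.
move=> /rowV0Pn[u /sub_kermxP u0 /negP]; apply; apply/eqP/rowP => j.
have: B (u *m span m a) (b j) = 0 by rewrite u0 pfB0l.
rewrite mulmx_sum_row (bigD1 j) //= pfBDl pfBZl rowK.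
rewrite (_ : B (\sum_(_ < _ | _) _) _ = 0); last first.
  elim/big_rec: _ => [|i x nij Bx]; first exact: pfB0l.
  by rewrite pfBDl pfBZl rowK Bx Bij ?mulr0 ?addr0.
by move/eqP; rewrite addr0 mulf_eq0 (negPf (Bii _ _)) // orbF mxE => /eqP.
Qed.

(** * Completing partial hyperbolic frames *)

Lemma hyp_frame_psing m l e f : hyp_frame m l e f -> psing (span m e).
Proof. by move=> fr; apply: psing_span; [apply: hf_qe fr|apply: hf_ee fr]. Qed.

(** A relation between the rows of [G] would give a nonzero combination of the [e i] perpendicular
    to everything; it is singular, so [pf_nondeg] forbids it. Hence [G] has a right inverse, and its
    column [k], twisted by the involution because [B] is semilinear on the right, is the vector
    sought. For [k] outside the range, 0 will do. *)
Lemma dual_vector m e k : row_free (span m e) -> psing (span m e) ->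
  exists v, forall i, (i < m)%N -> B (e i) v = (i == k)%:R.
Proof.
move=> free_e sing_e; pose G : 'M_(m, n) := \matrix_(i, j) B (e i) (delta_mx 0 j).
have BG i : forall v, B (e i) v = \sum_j s (v 0 j) * B (e i) (delta_mx 0 j).
  move=> v; rewrite {1}(row_sum_delta v).
  by elim/big_rec2: _ => [|j y1 y2 _ <-]; rewrite ?pfB0r // pfBDr pfBZr.
have free_G : row_free G.
  rewrite -kermx_eq0; apply/negPn/negP => /rowV0Pn[u /sub_kermxP uG0 /negP]; apply.
  have: u *m span m e == 0; last by rewrite mulmx_free_eq0.
  apply/negPn/negP => /(@pf_nondeg _ _ P).
  have [-> _] := sing_e _ _ (submxMl u (span m e)) (submxMl u (span m e)).
  case=> // v /negP[]; rewrite mulmx_sum_row.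
  have ->: B (\sum_i u 0 i *: row i (span m e)) v = \sum_i u 0 i * B (e i) v.
    by elim/big_rec2: _ => [|j y1 y2 _ <-]; rewrite ?pfB0l // pfBDl pfBZl rowK.
  under eq_bigr do rewrite BG mulr_sumr.
  rewrite exchange_big big1 // => j _.
  have /matrixP/(_ 0 j) := uG0; rewrite !mxE => G0.
  transitivity (s (v 0 j) * \sum_i u 0 i * G i j); last by rewrite G0 mulr0.
  by rewrite mulr_sumr; apply: eq_bigr => i _; rewrite mxE mulrCA.
have [H GH] := row_freeP free_G.
have [ltkm|lekm] := ltnP k m; last first.
  exists 0 => i ltim; rewrite pfB0r ltn_eqF //; exact: leq_trans lekm.
exists (\row_j s (H j (Ordinal ltkm))) => i ltim; rewrite BG.
have /matrixP/(_ (Ordinal ltim) (Ordinal ltkm)) := GH.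
rewrite !mxE -val_eqE /= => <-; apply: eq_bigr => j _.
by rewrite !mxE pfsK mulrC.
Qed.

Lemma hyp_frame_extend m l e f : (l < m)%N ->
  row_free (span m e) -> hyp_frame m l e f ->
  exists v, hyp_frame m l.+1 e (fun i => if i == l then v else f i).
Proof.
move=> ltlm free_e fr; have sing_e := hyp_frame_psing fr.
have [v0 Bv0] := dual_vector l free_e sing_e.
have [v1 [Bv1 Bfv1]] : exists v1, (forall i, (i < m)%N -> B (e i) v1 = (i == l)%:R)
    /\ (forall i, (i < l)%N -> B v1 (f i) = 0).
  (* The [e j] are mutually perpendicular, so removing these components makes the vector
     perpendicular to the old [f i] and keeps its products with all [e i]. *)
  exists (v0 - \sum_(j < l) B v0 (f j) *: e j); split=> i ltil.
    rewrite pfBDr pfBNr Bv0 // (_ : B _ (\sum_(_ < _) _) = 0) ?subr0 //.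
    elim/big_rec: _ => [|j y _ By]; first exact: pfB0r.
    by rewrite pfBDr pfBZr By (hf_ee fr) ?mulr0 ?addr0 // (ltn_trans (ltn_ord j)).
  rewrite pfBDl pfBNl; apply/eqP; rewrite subr_eq0; apply/eqP.
  have ->: B (\sum_(j < l) B v0 (f j) *: e j) (f i)
     = \sum_(j < l) B v0 (f j) * (j == i :> nat)%:R.
    elim/big_rec2: _ => [|j y1 y2 _ <-]; first exact: pfB0l.
    by rewrite pfBDl pfBZl (hf_ef fr) // (ltn_trans (ltn_ord j)).
  rewrite (bigD1 (Ordinal ltil)) //= eqxx mulr1 big1 ?addr0 // => j.
  by rewrite -val_eqE /= => /negPf ->; rewrite mulr0.
have [c tc] := pfq_tr P v1.
have Bvl : B v1 (e l) = eps by rewrite pfBC Bv1 // eqxx rmorph1 mulr1.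
(* The coefficient is chosen so that the polarization term is [t (- c)], which cancels
   [q v1 = t c]. *)
exists (v1 - s (eps * c) *: e l); set v := v1 - _.
have qv : q v = 0.
  rewrite /v -scaleNr pfqD pfqZ (hf_qe fr) // mulr0 addr0 pfBZr Bvl -tc -pftD.
  rewrite -[RHS]pft0; congr t; rewrite rmorphN pfsK.
  by have e2 := pfe2 P; ring: e2.
have Bv i : (i < m)%N -> B (e i) v = (i == l)%:R.
  by move=> ltim; rewrite /v !pfBE Bv1 // (hf_ee fr) // mulr0 subr0.
have Bvf i : (i < l)%N -> B v (f i) = 0.
  move=> ltil; rewrite /v !pfBE Bfv1 // (hf_ef fr) //.
  by rewrite eq_sym ltn_eqF // mulr0 subr0.
have lt1 i : (i < l.+1)%N -> (i == l) = false -> (i < l)%N.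
  by rewrite ltnS leq_eqVlt => /predU1P[->|//]; rewrite eqxx.
split=> [|i lti||i j lti ltj|i j ltim ltj]; try by case: fr.
- case: ifPn => [//|/negPf /(lt1 _ lti)]; exact: (hf_qf fr).
- case: ifPn => [_|/negPf /(lt1 _ lti) {}lti];
    case: ifPn => [_|/negPf /(lt1 _ ltj) {}ltj].
  + exact: pfq_iso.
  + exact: Bvf.
  + exact/pfB0C/Bvf.
  + exact: (hf_ff fr).
case: ifPn => [/eqP ->|/negPf /(lt1 _ ltj) {}ltj]; first exact: Bv.
exact: (hf_ef fr).
Qed.

Lemma hyp_frame_complete m l e f : (l <= m)%N ->
  row_free (span m e) -> hyp_frame m l e f ->
  exists f', hyp_frame m m e f' /\ forall i, (i < l)%N -> f' i = f i.
Proof.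
move=> lelm free_e fr; have [d] : exists d, (d + l = m)%N by exists (m - l)%N; rewrite subnK.
elim: d l f fr {lelm} => [|d IHd] l f fr dlm.
  by exists f; split=> //; rewrite -dlm in fr *.
have [|v frv] := hyp_frame_extend _ free_e fr; first by rewrite -dlm addSn ltnS leq_addl.
have [|f' [fr' ff']] := IHd _ _ frv; first by rewrite addnS -addSn.
exists f'; split=> // i ltil; rewrite ff' ?(ltnW ltil) // ?ltn_eqF //.
exact: ltnW.
Qed.

Lemma hyp_frame_rcons l e f c d :
  hyp_frame l l e f -> q c = 0 -> q d = 0 -> B c d = 1 ->
  (forall i, (i < l)%N -> [/\ B (e i) c = 0, B (f i) c = 0, B (e i) d = 0
                            & B (f i) d = 0]) ->
  hyp_frame l.+1 l.+1 (fun i => if i == l then c else e i)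
                      (fun i => if i == l then d else f i).
Proof.
move=> fr qc qd Bcd Bl.
have lt1 i : (i < l.+1)%N -> (i == l) = false -> (i < l)%N.
  by rewrite ltnS leq_eqVlt => /predU1P[->|//]; rewrite eqxx.
split=> [i lti|i lti|i j lti ltj|i j lti ltj|i j lti ltj].
- by case: ifPn => [//|/negPf /(lt1 _ lti)]; apply: (hf_qe fr).
- by case: ifPn => [//|/negPf /(lt1 _ lti)]; apply: (hf_qf fr).
- case: ifPn => [_|/negPf /(lt1 _ lti) {}lti];
    case: ifPn => [_|/negPf /(lt1 _ ltj) {}ltj]; first exact: pfq_iso.
  + by have [/pfB0C] := Bl j ltj.
  + by have [] := Bl i lti.
  + exact: (hf_ee fr).
- case: ifPn => [_|/negPf /(lt1 _ lti) {}lti];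
    case: ifPn => [_|/negPf /(lt1 _ ltj) {}ltj]; first exact: pfq_iso.
  + by have [_ _ _ /pfB0C] := Bl j ltj.
  + by have [] := Bl i lti.
  + exact: (hf_ff fr).
case: ifPn => [/eqP ->|/negPf /[dup] il /(lt1 _ lti) {}lti];
  case: ifPn => [/eqP -> //|/negPf /[dup] jl /(lt1 _ ltj) {}ltj].
- by rewrite eqxx.
- by have [_ /pfB0C -> _ _] := Bl j ltj; rewrite eq_sym jl.
- by have [_ _ -> _] := Bl i lti; rewrite il.
exact: (hf_ef fr).
Qed.

(** A singular vector perpendicular to the whole frame contributes nothing to any product. *)
Lemma hyp_frame_shift m l e f c (a b : nat -> F) : hyp_frame m l e f -> q c = 0 ->
  (forall i, (i < m)%N -> B (e i) c = 0) -> (forall i, (i < l)%N -> B (f i) c = 0) ->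
  hyp_frame m l (fun i => e i + a i *: c) (fun i => f i + b i *: c).
Proof.
move=> fr qc ec fc; have Bcc := pfq_iso qc.
split=> [i lti|i lti|i j lti ltj|i j lti ltj|i j lti ltj].
- by rewrite pfqD0 ?pfqZ0 ?(hf_qe fr) // pfBZr ec ?mulr0.
- by rewrite pfqD0 ?pfqZ0 ?(hf_qf fr) // pfBZr fc ?mulr0.
- by rewrite !pfBE (hf_ee fr) // ec // (pfB0C (ec j ltj)) Bcc !mulr0 !addr0.
- by rewrite !pfBE (hf_ff fr) // fc // (pfB0C (fc j ltj)) Bcc !mulr0 !addr0.
by rewrite !pfBE (hf_ef fr) // ec // (pfB0C (fc j ltj)) Bcc !mulr0 !addr0.
Qed.

(* A pair [(b, i)] names the basis vector [f i] if [b] holds, else [e i]. *)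
Definition frame_vec (e f : nat -> 'rV[F]_n) (p : bool * nat) : 'rV[F]_n :=
  if p.1 then f p.2 else e p.2.

(** Naming subspaces by lists of indices turns perpendicularity, rank and inclusion into conditions
    on lists. *)
Definition frame_span e f (L : seq (bool * nat)) : 'M[F]_(size L, n) :=
  span (size L) (fun i => frame_vec e f (nth (false, 0%N) L i)).

Lemma frame_span_subP e f L p (U : 'M_(p, n)) :
  reflect {in L, forall r, (frame_vec e f r <= U)%MS} (frame_span e f L <= U)%MS.
Proof.
apply: (iffP (span_subP _ _ _)) => [H r rL|H i ltiL]; last exact/H/mem_nth.
by have := H (index r L); rewrite index_mem nth_index // => ->.
Qed.

Lemma frame_spanS e f L L' : {subset L <= L'} ->
  (frame_span e f L <= frame_span e f L')%MS.
Proof. by move=> sLL'; apply/frame_span_subP => r /sLL'; apply/frame_span_subP. Qed.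

Lemma mem_frame_span e f L r : r \in L -> (frame_vec e f r <= frame_span e f L)%MS.
Proof. by move: r; apply/frame_span_subP. Qed.

Section FrameVectors.
Variables (m : nat) (e f : nat -> 'rV[F]_n).
Hypothesis fr : hyp_frame m m e f.

Lemma frame_vec_q r : (r.2 < m)%N -> q (frame_vec e f r) = 0.
Proof. by case: r => -[] i /=; [apply: (hf_qf fr) | apply: (hf_qe fr)]. Qed.

Lemma frame_vec_B0 r r' : (r.2 < m)%N -> (r'.2 < m)%N ->
  (r.1 == r'.1) || (r.2 != r'.2) -> B (frame_vec e f r) (frame_vec e f r') = 0.
Proof.
case: r r' => [[] i] [[] j] /= lti ltj.
- by rewrite (hf_ff fr).
- by move=> /negPf nij; apply: pfB0C; rewrite (hf_ef fr) // eq_sym nij.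
- by move=> /negPf nij; rewrite (hf_ef fr) // nij.
- by rewrite (hf_ee fr).
Qed.

Lemma frame_vec_B r r' : (r.2 < m)%N -> r.1 != r'.1 -> r.2 = r'.2 ->
  B (frame_vec e f r) (frame_vec e f r') != 0.
Proof.
case: r r' => [[] i] [[] j] //= lti _ <-; rewrite ?[B (f _) _ == _]pfB_eq0C;
by rewrite (hf_ef fr) // eqxx oner_neq0.
Qed.

(** Distinct indices prevent [e i] and [f i] from occurring together, whence singularity; the
    partners of the listed vectors form a dual family, whence the rank. *)
Lemma frame_span_psing L : all (fun r => r.2 < m)%N L -> uniq (map snd L) ->
  psing (frame_span e f L) /\ \rank (frame_span e f L) = size L.
Proof.
move=> /allP Lm uL; pose r i := nth (false, 0%N) L i.
have rm i : (i < size L)%N -> ((r i).2 < m)%N by move=> lti; apply/Lm/mem_nth.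
have r2 i j : (i < size L)%N -> (j < size L)%N -> i != j -> (r i).2 != (r j).2.
  move=> lti ltj; rewrite -!(nth_map _ 0%N) //.
  by rewrite nth_uniq ?size_map.
split.
  apply: psing_span => [i lti|i j lti ltj]; first exact/frame_vec_q/rm.
  apply: frame_vec_B0; rewrite ?rm //.
  by have [->|/r2 ->] := eqVneq i j; rewrite ?eqxx ?orbT.
apply/eqP; apply: (@row_free_dual _ _ (fun i => frame_vec e f (~~ (r i).1, (r i).2))).
  by move=> i j lti ltj /r2 nij; rewrite frame_vec_B0 ?rm //= nij ?orbT.
by move=> i lti; apply: frame_vec_B; rewrite ?rm //=; case: (r i).1.
Qed.

Lemma frame_span_perp L r : all (fun r => r.2 < m)%N (r :: L) ->
  all (fun r' => (r'.1 == r.1) || (r'.2 != r.2)) L ->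
  (frame_span e f L <= perpmx (frame_vec e f r))%MS.
Proof.
move=> /= /andP[rm /allP Lm] /allP LB; apply/frame_span_subP => r' r'L.
by apply/perpmxP/frame_vec_B0; [apply: Lm | apply: rm | apply: LB].
Qed.

End FrameVectors.

Lemma span_basis m (U : 'M[F]_(m, n)) : exists b, (span (\rank U) b :=: U)%MS.
Proof.
pose b i := if insub i is Some j then row j (row_base U) else 0.
exists b; apply: eqmx_trans (eq_row_base U).
suff -> : span (\rank U) b = row_base U by [].
apply/row_matrixP => i; rewrite rowK /b insubT //= => lti.
by congr (row _ _); apply: val_inj.
Qed.

End PolarForm.

Lemma eqmx_of_rank (F : fieldType) m1 m2 n (A : 'M[F]_(m1, n)) (B : 'M_(m2, n)) :
  (A <= B)%MS -> (\rank B <= \rank A)%N -> (A :=: B)%MS.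
Proof.
move=> sAB rBA; apply/eqmxP; rewrite sAB -(geq_leqif (mxrank_leqif_sup sAB)) //.
Qed.

Lemma rank_adds_vec (F : fieldType) m n (U : 'M[F]_(m, n)) (v : 'rV_n) :
  ~~ (v <= U)%MS -> \rank (U + v)%MS = (\rank U).+1.
Proof.
move=> nvU; have v0 : v != 0%R by apply: contraNneq nvU => ->; apply: sub0mx.
have := mxrank_sum_cap U v; rewrite rank_rV v0 addn1.
suff -> : \rank (U :&: v)%MS = 0%N by rewrite addn0.
apply/eqP; rewrite mxrank_eq0; apply: contraNT nvU => c0.
have : (v <= U :&: v)%MS; last by rewrite sub_capmx => /andP[].
rewrite -(geq_leqif (mxrank_leqif_sup (capmxSr U v))) rank_rV v0.
by rewrite lt0n mxrank_eq0.
Qed.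

(** * The polar form of a formed space *)

Section FormedSpaces.
Local Open Scope ring_scope.
Variables (F : finFieldType) (n : nat).
Implicit Types (M A : 'M[F]_n) (s : {rmorphism F -> F}) (u v w : 'rV[F]_n).

Lemma form_valDl M (s : F -> F) u v w :
  form_val M s (u + v) w = form_val M s u w + form_val M s v w.
Proof. by rewrite /form_val !mulmxDl mxE. Qed.

Lemma form_valZl M (s : F -> F) a u v :
  form_val M s (a *: u) v = a * form_val M s u v.
Proof. by rewrite /form_val -!scalemxAl mxE. Qed.

Lemma form_valC M s eps u v : involutive s -> M^T = eps *: map_mx s M ->
  form_val M s v u = eps * s (form_val M s u v).
Proof.
move=> sK MT; rewrite /form_val.
have tr11 (X : 'M[F]_1) : X 0 0 = X^T 0 0 by rewrite mxE.
have s11 (X : 'M[F]_1) : s (X 0 0) = (map_mx s X) 0 0 by rewrite mxE.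
rewrite tr11 s11 !trmx_mul trmxK MT -scalemxAl -scalemxAr mxE; congr (_ * _).
rewrite !map_mxM map_trmx mulmxA; congr ((_ *m _) 0 0).
by apply/matrixP => i j; rewrite !mxE sK.
Qed.

Lemma form_val_nondeg M s u : M \in unitmx -> u != 0 ->
  exists v, form_val M s u v != 0.
Proof.
move=> Mu; have [uM0|/rV0Pn[j uMj] _] := eqVneq (u *m M) 0.
  by rewrite -(mulmxK Mu u) uM0 mul0mx eqxx.
exists (delta_mx 0 j); rewrite /form_val.
suff -> : (map_mx s (delta_mx 0 j))^T = delta_mx j 0 :> 'cV_n by rewrite -colE mxE.
by rewrite map_delta_mx trmx_delta.
Qed.

Lemma quad_formD A u v :
  quad_form A (u + v) = quad_form A u + quad_form A v + form_val (A + A^T) id u v.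
Proof.
have addE (X Y : 'M[F]_1) : (X + Y) 0 0 = X 0 0 + Y 0 0 by rewrite mxE.
rewrite /quad_form /form_val map_mx_id // linearD /=.
rewrite !(mulmxDl, mulmxDr) !addE.
have -> : (u *m A^T *m v^T) 0 0 = (v *m A *m u^T) 0 0.
  have tr11 (X : 'M[F]_1) : X 0 0 = X^T 0 0 by rewrite mxE.
  by rewrite tr11 !trmx_mul !trmxK mulmxA.
ring.
Qed.

Lemma quad_formZ A a u : quad_form A (a *: u) = a * a * quad_form A u.
Proof.
by rewrite /quad_form linearZ /= -!scalemxAl -scalemxAr scalerA mxE.
Qed.

Lemma symplectic_polar_form M : formed_nondegenerate (Symplectic M) ->
  exists P : polar_form F n, forall U, fs_singular (Symplectic M) U <-> psing P U.
Proof.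
move=> [MT Mii Mu].
have BC u v : form_val M id v u = -1 * form_val M id u v.
  by apply: (@form_valC M idfun) => //; rewrite map_mx_id // scaleN1r.
(* Antisymmetry does not suffice in characteristic 2; the zero diagonal enters through an expansion
   over the standard basis. *)
have Buu u : form_val M id u u = 0.
  rewrite [u]row_sum_delta; elim/big_rec: _ => [|i v _ Bvv].
    by rewrite -(scale0r (0 : 'rV_n)) form_valZl mul0r.
  have Mi : form_val M id (delta_mx 0 i) (delta_mx 0 i) = 0.
    by rewrite /form_val map_mx_id // trmx_delta -rowE -colE !mxE.
  set x := u 0 i *: _; have Bxx : form_val M id x x = 0.
    by rewrite form_valZl BC form_valZl Mi !mulr0.
  rewrite form_valDl (BC (x + v) x) (BC (x + v) v) !form_valDl Bvv Bxx (BC v x).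
  by ring.
unshelve refine (ex_intro _ (@PolarForm F n (form_val M id) idfun (-1)
  (fun=> 0) (fun=> 0) (form_valDl M id) (form_valZl M id)
  _ _ _ _ _ _ _ _ _ _ _ _) _) => //=.
- by rewrite mulrNN mul1r.
- by move=> *; rewrite !addr0.
- by move=> *; rewrite mulr0.
- by move=> *; rewrite addr0.
- by move=> *; rewrite mulr0.
- by move=> *; exists 0.
- by move=> u u0 _; apply: (@form_val_nondeg M idfun).
move=> U; split=> [/forallP sU u v uU vU|sU].
  by have /forallP/(_ v) := sU u; rewrite uU vU /= => /eqP.
apply/forallP => u; apply/forallP => v; apply/implyP => /andP[uU vU].
by case: (sU u v uU vU) => /= _ ->.
Qed.

Lemma orthogonal_polar_form A : formed_nondegenerate (Orthogonal A) ->
  exists P : polar_form F n, forall U, fs_singular (Orthogonal A) U <-> psing P U.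
Proof.
move=> nondegA; pose B := form_val (A + A^T) id.
have BC u v : B v u = 1 * B u v.
  apply: (@form_valC _ idfun) => //; rewrite map_mx_id // scale1r.
  by rewrite linearD /= trmxK addrC.
have Buu u : B u u = 2%:R * quad_form A u.
  have := quad_formD A u u; rewrite -/(B u u) -[in LHS](scale1r u) -scalerDl.
  rewrite quad_formZ => H; rewrite -[LHS](addKr (quad_form A u + quad_form A u)) -H.
  by ring.
unshelve refine (ex_intro _ (@PolarForm F n B idfun 1
  (quad_form A) id (form_valDl _ id) (form_valZl _ id)
  _ _ _ _ _ _ _ _ _ _ _ _) _) => //=.
- by rewrite mul1r.
- by move=> *; apply: quad_formD.
- by move=> *; apply: quad_formZ.
- by move=> *; rewrite mul1r.
- by move=> u; exists (quad_form A u).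
- by move=> u qu; rewrite Buu qu mulr0.
(* A nonzero vector perpendicular to everything would lie in the radical of [B], where the
   hypothesis keeps the quadratic form nonzero. *)
- move=> u u0 qu; have [/existsP //|/existsPn nB] := boolP [exists v, B u v != 0].
  suff /(nondegA u u0) : forall v, bform (Orthogonal A) v u = 0 by rewrite qu eqxx.
  by move=> v; rewrite /= -/(B v u) BC mul1r; apply/eqP/negPn/nB.
move=> U; split=> [/forallP sU u v uU vU|sU].
  have qU w : (w <= U)%MS -> quad_form A w = 0.
    by move=> wU; have /implyP/(_ wU)/eqP := sU w.
  split; first exact: qU; have := quad_formD A u v.
  by rewrite !qU ?addmx_sub // !add0r => /esym.
by apply/forallP => u; apply/implyP => uU; case: (sU u u uU uU) => /= ->.
Qed.

Lemma unitary_polar_form (s0 : F -> F) M : formed_nondegenerate (Unitary s0 M) ->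
  exists P : polar_form F n, forall U, fs_singular (Unitary s0 M) U <-> psing P U.
Proof.
move=> [[sD sM s1] [sK [x0 sx0]] MT Mu].
have s_zmod : zmod_morphism s0.
  have sN x : s0 (- x) = - s0 x.
    apply/eqP; rewrite -addr_eq0 -sD addNr.
    by apply/eqP/(@addrI _ (s0 0)); rewrite -sD !addr0.
  by move=> x y; rewrite sD sN.
pose sA := GRing.isZmodMorphism.Build F F s0 s_zmod.
pose sMM := GRing.isMonoidMorphism.Build F F s0 (conj s1 sM).
pose s : {rmorphism F -> F} := HB.pack s0 sA sMM.
pose B := form_val M s0; pose tr x := x + s x.
have BC u v : B v u = 1 * s (B u v).
  by apply: (@form_valC _ s) => //; rewrite scale1r.
have BDr u v w : B u (v + w) = B u v + B u w.
  by rewrite !(BC _ u) [B (v + w) u]form_valDl rmorphD mulrDr.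
have BZr a u v : B u (a *: v) = s a * B u v.
  by rewrite !(BC _ u) [B (a *: v) u]form_valZl rmorphM mulrCA.
(* Needed for [pfq_tr]: [tr a] and [B u u] are fixed by [s], so [a / tr a * B u u] has trace
   [B u u]. In characteristic 2, where [tr 1 = 0], an element moved by [s] is taken. *)
have [a sa] : exists a, tr a != 0.
  have [c2|] := eqVneq (1 + 1 : F) 0; last first.
    by exists 1; rewrite /tr rmorph1.
  exists x0; apply: contra sx0 => /eqP tx; apply/eqP.
  have -> : s0 x0 = tr x0 - x0 by rewrite /tr addrC addKr.
  have dbl : x0 + x0 = 0 by rewrite -(mul1r x0) -mulrDl c2 mul0r.
  by rewrite tx -dbl addrK.
unshelve refine (ex_intro _ (@PolarForm F n B s 1
  (fun u => B u u) tr (form_valDl _ s0) (form_valZl _ s0)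
  _ _ _ _ _ _ _ _ _ _ _ _) _) => //=.
- by rewrite mul1r.
- move=> u v; rewrite /tr BDr ![B (u + v) _]form_valDl -!/(B _ _) (BC u v).
  by ring.
- by move=> b u; rewrite BZr [B (b *: u) u]form_valZl mulrCA mulrA.
- by move=> b c; rewrite /tr rmorphD; ring.
- by move=> b; rewrite /tr mul1r [s (s0 b)]sK addrC.
- by move=> b c sb; rewrite /tr rmorphM [s b]sb mulrDr.
- move=> u; exists (a / tr a * B u u); rewrite /tr !rmorphM fmorphV -/(tr a).
  have -> : s (tr a) = tr a by rewrite /tr rmorphD [s (s a)]sK addrC.
  have -> : s (B u u) = B u u by rewrite [RHS]BC mul1r.
  by rewrite -!mulrDl -/(tr a) divff // mul1r.
- by move=> u u0 _; apply: (@form_val_nondeg M s).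
move=> U; split=> [/forallP sU u v uU vU|sU].
  have BU x y : (x <= U)%MS -> (y <= U)%MS -> B x y = 0.
    by move=> xU yU; have /forallP/(_ y) := sU x; rewrite xU yU /= => /eqP.
  by rewrite /= !BU.
apply/forallP => u; apply/forallP => v; apply/implyP => /andP[uU vU].
by case: (sU u v uU vU) => /= _ /eqP.
Qed.

Lemma formed_space_polar_form (W : formed_space F n) : formed_nondegenerate W ->
  exists P : polar_form F n, forall U, fs_singular W U <-> psing P U.
Proof.
by case: W => [M|A|s M]; [apply: symplectic_polar_form|
  apply: orthogonal_polar_form|apply: unitary_polar_form].
Qed.

End FormedSpaces.

(** * Polar Grassmann graphs *)

Section PolarGrassmann.
Local Open Scope ring_scope.
Variables (F : finFieldType) (n : nat) (W : formed_space F n) (P : polar_form F n).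
Hypothesis singW : forall U, fs_singular W U <-> psing P U.
Variable k : nat.
Local Notation B := (pfB P).
Local Notation q := (pfq P).
Local Notation perp := (perpmx P).
Local Notation psing := (psing P).
Local Notation omega := (witt_index W).
Local Notation adj := (polar_adj W k).
Implicit Types (x y z : vert W k) (g : 'M[F]_n).

Lemma psing_rank m (U : 'M_(m, n)) : psing U -> (\rank U <= omega)%N.
Proof.
move=> sU; rewrite -genmxE; apply: (@leq_bigmax_cond _ _ (fun U : 'M_n => \rank U)).
by apply/singW; apply: psingS sU; rewrite genmxE.
Qed.

(** A singular subspace of maximal rank gives a frame with no [f] at all, which is then
    completed. *)
Lemma witt_frame : exists e f, hyp_frame P omega omega e f.
Proof.
have [|U] := @eq_bigmax_cond _ (fs_singular W) (fun U => \rank U).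
  apply/card_gt0P; exists 0; apply/singW => u v.
  by rewrite !submx0 => /eqP -> /eqP ->; rewrite pfq0 pfB0l.
move=> /singW sU rU; have {}rU : omega = \rank U by [].
have [e eU] := span_basis U; exists e; rewrite rU.
have se : psing (span (\rank U) e) by apply: psingS sU; rewrite eU.
have fre : hyp_frame P (\rank U) 0 e (fun=> 0).
  split=> // [i lti|i j lti ltj].
    by have [] := se _ _ (mem_span e lti) (mem_span e lti).
  by have [] := se _ _ (mem_span e lti) (mem_span e ltj).
have [//||f [fr _]] := hyp_frame_complete _ _ fre; last by exists f.
by apply/eqP; rewrite -[RHS]eU.
Qed.

Lemma vert_psing x : psing (val x).
Proof. by case: x => U /= /and3P[_ _ /singW]. Qed.

Lemma vert_rank x : \rank (val x) = k.
Proof. by case: x => U /= /and3P[_ /eqP]. Qed.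

Lemma vert_eqP x y : reflect (val x :=: val y)%MS (x == y).
Proof.
apply: (iffP eqP) => [-> //|exy]; apply: val_inj.
case: x y exy => [U /= /and3P[/eqP gU _ _]] [V /= /and3P[/eqP gV _ _]] /eqmxP.
by move/genmxP; rewrite gU gV.
Qed.

Lemma vert_sub_eq x y : (val x <= val y)%MS -> x = y.
Proof.
by move=> sxy; apply/eqP/vert_eqP/eqmx_of_rank; rewrite ?vert_rank.
Qed.

Lemma vert_exists m (U : 'M_(m, n)) : psing U -> \rank U = k ->
  exists x, (val x :=: U)%MS.
Proof.
move=> sU rU; have vU : polar_vpred W k <<U>>%MS.
  rewrite /polar_vpred genmx_id eqxx genmxE rU eqxx /=.
  by apply/singW; apply: psingS sU; rewrite genmxE.
by exists (Sub <<U>>%MS vU); rewrite SubK; apply: genmxE.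
Qed.

Lemma fs_singular_eqmx U V : (U :=: V)%MS -> fs_singular W U = fs_singular W V.
Proof. by move=> UV; apply/idP/idP => /singW sU; apply/singW/(psingS _ sU); rewrite UV. Qed.

Lemma isometry_aut g : isometry P g ->
  exists h : {perm vert W k}, is_aut adj h /\ forall x, (val (h x) :=: val x *m g)%MS.
Proof.
move=> isog; have free_g : row_free g by rewrite row_free_unit (isometry_unit isog).
have ex x : exists y, (val y == val x *m g)%MS.
  have [||y yE] := @vert_exists _ (val x *m g).
  - exact/psing_mul/vert_psing.
  - by rewrite mxrankMfree // vert_rank.
  by exists y; apply/eqmxP.
pose h0 x := xchoose (ex x).
have h0E x : (val (h0 x) :=: val x *m g)%MS by apply/eqmxP/(xchooseP (ex x)).
have h0_inj : injective h0.
  move=> x y hxy; apply: vert_sub_eq; rewrite -(submxMfree _ _ free_g).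
  by rewrite -h0E -h0E hxy.
exists (perm h0_inj); split=> [x y|x]; last by rewrite permE.
rewrite !permE /polar_adj.
have addE : (val (h0 x) + val (h0 y) :=: (val x + val y)%MS *m g)%MS.
  by exact: eqmx_trans (adds_eqmx (h0E x) (h0E y)) (eqmx_sym (addsmxMr _ _ _)).
have capE : (val (h0 x) :&: val (h0 y) :=: (val x :&: val y)%MS *m g)%MS.
  apply: eqmx_trans (cap_eqmx (h0E x) (h0E y)) _; apply/eqmxP.
  rewrite capmxMr andbT; apply/rV_subP => u.
  by rewrite -(mulmxKV (isometry_unit isog) u) sub_capmx !submxMfree // -sub_capmx.
rewrite addE capE !mxrankMfree //; case: ifP => // _.
rewrite !(inj_eq val_inj) (inj_eq h0_inj) (fs_singular_eqmx addE).
congr [&& _, _ & _]; apply/idP/idP => /singW s.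
  apply/singW => u v uxy vxy; have [Bg qg] := isog.
  by rewrite -qg -Bg; apply: s; apply: submxMr.
by apply/singW/psing_mul.
Qed.

Lemma geodesic_conj x y p r g : isometry P g -> size p = size r ->
  (forall i, (i <= size p)%N ->
     (val (nth x (x :: p) i) *m g :=: val (nth y (y :: r) i))%MS) ->
  exists h : {perm vert W k}, [/\ is_aut adj h, h x = y & map h p = r].
Proof.
move=> isog spr prg; have [h [auth hE]] := isometry_aut isog.
have hpr i : (i <= size p)%N -> h (nth x (x :: p) i) = nth y (y :: r) i.
  by move=> lei; apply/eqP/vert_eqP/(eqmx_trans (hE _) (prg i lei)).
exists h; split=> //; first exact: (hpr 0%N).
apply: (@eq_from_nth _ y) => [|i]; rewrite size_map // => lti.
by rewrite (nth_map x) //; apply: (hpr i.+1).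
Qed.

(** * The dual polar graph *)

Section MaximalSubspaces.
Hypothesis k_max : k = omega.

Lemma adj_max x y : adj x y = (\rank (val x :&: val y)%MS == k.-1).
Proof. by rewrite /polar_adj; have /eqP -> := k_max. Qed.

(** The distance is at most the codimension of the intersection. For [v] in [y] outside [x], the
    neighbour [(x :&: perp v) + v] of [x] contains [v] and also [x :&: y], because [y] is singular.
    Its rank is [k]: a hyperplane section loses at most one dimension, and the Witt index bounds it
    above. *)
Lemma walkb_max d x y : (k <= \rank (val x :&: val y)%MS + d)%N ->
  exists2 j, (j <= d)%N & walkb adj x y j.
Proof.
elim: d x => [|d IHd] x rxy; have [/vert_sub_eq exy|] := boolP (val x <= val y)%MS.
- by exists 0%N; rewrite // walkb0 exy.
- rewrite addn0 in rxy; case/negP.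
  have: (val x <= val x :&: val y)%MS; last by rewrite sub_capmx => /andP[].
  by rewrite -(geq_leqif (mxrank_leqif_sup (capmxSl _ _))) vert_rank.
- by exists 0%N; rewrite // walkb0 exy.
move=> nxy; have nyx : ~~ (val y <= val x)%MS.
  by apply: contra nxy => /vert_sub_eq ->.
have [i vx] := row_subPn nyx; set v := row i (val y) in vx.
have vy : (v <= val y)%MS := row_sub i _.
have [qv _] := vert_psing vy vy.
pose H := (val x :&: perp v)%MS.
have vH : ~~ (v <= H)%MS by rewrite sub_capmx negb_and vx.
have sHv : psing (H + v)%MS.
  apply: psing_adds; first exact: psingS (capmxSl _ _) (@vert_psing x).
    exact: psing_vec.
  move=> u w; rewrite sub_capmx => /andP[_ /perpmxP uv] /sub_rVP[a ->].
  by rewrite pfBZr uv mulr0.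
have rH : (k <= (\rank H).+1)%N.
  by rewrite -[X in (X <= _)%N](vert_rank x); apply: rank_perpmx.
have rHv : \rank (H + v)%MS = k.
  by apply/eqP; rewrite eqn_leq {1}k_max psing_rank //= rank_adds_vec.
have [z zE] := vert_exists sHv rHv.
have vz : (v <= val z)%MS by rewrite zE addsmxSr.
have Hxz : (H <= val x :&: val z)%MS by rewrite sub_capmx capmxSl zE addsmxSl.
have axz : adj x z.
  have rHk : k.-1 = \rank H by rewrite -[RHS]/((\rank H).+1.-1) -(rank_adds_vec vH) rHv.
  rewrite adj_max rHk eqn_leq (mxrankS Hxz) andbT.
  rewrite -ltnS -(rank_adds_vec vH) rHv -[X in (_ < X)%N](vert_rank z).
  rewrite ltn_neqAle mxrankS ?capmxSr // andbT (mxrank_leqif_sup (capmxSr _ _)).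
  apply: contra vx => szxz.
  by have := submx_trans vz szxz; rewrite sub_capmx => /andP[].
have [|j lejd w] := IHd z; last by exists j.+1; [exact: lejd | exact: walkb_cons axz w].
apply: leq_trans rxy _; rewrite addnS -addSn leq_add2r.
have nv : ~~ (v <= val x :&: val y)%MS by rewrite sub_capmx negb_and vx.
rewrite -(rank_adds_vec nv); apply: mxrankS.
rewrite addsmx_sub !sub_capmx vz vy capmxSr !andbT zE.
apply: submx_trans (addsmxSl _ _); rewrite sub_capmx capmxSl /=.
apply/rV_subP => u; rewrite sub_capmx => /andP[_ uy].
by apply/perpmxP; have [] := vert_psing uy vy.
Qed.

Lemma connected_max : graph_connected adj.
Proof.
by move=> x y; have [|j _ w] := @walkb_max k x y; [apply: leq_addl | exists j].
Qed.

Definition swap_below (i : nat) (e f : nat -> 'rV[F]_n) (j : nat) : 'rV[F]_n :=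
  if (j < i)%N then f j else e j.

(* Extending a geodesic by [z]: pick [c] in [E] outside [z] and [d] in [z] with
   [B c d = 1] as the new pair.  Multiples of [c] are added to the old [e i] and
   [f i] to make them perpendicular to [d], resp. members of [z]; this changes no
   earlier vertex since all of them contain [c]. *)
Lemma geodesic_max x p : geodesic adj x p -> exists e f (E : 'M[F]_n),
  [/\ hyp_frame P (size p) (size p) e f, psing E, (size p + \rank E = k)%N,
      forall i, (i < size p)%N -> (E <= perp (e i))%MS /\ (E <= perp (f i))%MS
    & forall i, (i <= size p)%N ->
        (val (nth x (x :: p) i) :=: span (size p) (swap_below i e f) + E)%MS].
Proof.
elim/last_ind: p => [_|p z IHp].
  exists (fun=> 0), (fun=> 0), (val x); split=> //; first exact: (@vert_psing x).
    exact: vert_rank.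
  case=> // _; apply/eqmxP; rewrite addsmxSr addsmx_sub submx_refl andbT.
  exact/span_subP.
move=> /geodesic_rcons[/IHp[e [f [E [fr sE rE Eef spanE]]]] ayz farz].
have nthp i : (i <= size p)%N -> nth x (x :: rcons p z) i = nth x (x :: p) i.
  by move=> lei; rewrite -rcons_cons nth_rcons /= ltnS lei.
have nthz : nth x (x :: rcons p z) (size p).+1 = z.
  by rewrite -rcons_cons nth_rcons /= ltnn eqxx.
have nthy : nth x (x :: p) (size p) = last x p by rewrite -(last_nth x x p).
rewrite size_rcons; set y := last x p in ayz nthy.
set l := size p in fr rE Eef spanE farz nthp nthz nthy *.
have yE : (val y :=: span l f + E)%MS.
  rewrite -nthy; apply: eqmx_trans (spanE l (leqnn l)) _.
  by rewrite (@eq_span _ _ l _ f) // => j ltjl; rewrite /swap_below ltjl.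
have Ex : (E <= val x)%MS.
  by have := spanE 0%N isT; rewrite /= => ->; apply: addsmxSr.
(* [E] lies in [x] and has rank [k - l]; if [z] contained it, there would be a walk of length at
   most [l] from [x] to [z]. *)
have nEz : ~~ (E <= val z)%MS.
  apply/negP => Ez; have [|j lej] := @walkb_max l x z.
    by rewrite -[X in (X <= _)%N]rE addnC leq_add2r mxrankS // sub_capmx Ex.
  exact/negP/farz.
have [i0 cz] := row_subPn nEz; set c := row i0 E in cz.
have cE : (c <= E)%MS := row_sub i0 _.
have [qc Bcc] := sE _ _ cE cE.
have cy : (c <= val y)%MS by rewrite yE (submx_trans cE) ?addsmxSr.
have BcE u : (u <= E)%MS -> B u c = 0 by move=> uE; have [] := sE u c uE cE.
(* [y :&: z] is a hyperplane of [y] that misses [c], so each vector of [y] can be moved into [z]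
   along [c]. *)
have [a az] : exists a : 'rV_n -> F,
    forall u, (u <= val y)%MS -> ((u + a u *: c)%R <= val z)%MS.
  exists (fun u => odflt 0 [pick a | ((u + a *: c)%R <= val z)%MS]) => u uy.
  case: pickP => // nz; have: (u <= (val y :&: val z) + c)%MS.
    apply: submx_trans uy _; have sHy : ((val y :&: val z) + c <= val y)%MS.
      by rewrite addsmx_sub capmxSl.
    rewrite -(geq_leqif (mxrank_leqif_sup sHy)) vert_rank rank_adds_vec.
      rewrite (eqP (etrans (esym (adj_max y z)) ayz)).
      exact: leqSpred.
    by rewrite sub_capmx negb_and cz orbT.
  case/sub_addsmxP=> -[b1 b2] /= uE; have [b bE] := sub_rVP (submxMl b2 c).
  have := nz (- b); rewrite uE bE scaleNr addrK.
  by rewrite (submx_trans (submxMl _ _)) ?capmxSr.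
(* If [z] were perpendicular to [c], then [z + c] would be singular of rank [k + 1], above the Witt
   index. *)
have [d [dz Bcd]] : exists d, (d <= val z)%MS /\ B c d = 1.
  have: ~~ (val z <= perp c)%MS.
    apply/negP => zc; suff : (\rank (val z + c)%MS <= omega)%N.
      by rewrite rank_adds_vec // vert_rank -k_max ltnn.
    apply: psing_rank; apply: psing_adds (psing_vec qc) _.
      exact: (@vert_psing z).
    move=> u v uz /sub_rVP[b ->]; rewrite pfBZr.
    by rewrite (perpmxP _ _ _ (submx_trans uz zc)) mulr0.
  case/row_subPn => j /perpmxP/eqP; set v := row j _; rewrite pfB_eq0C => Bcv.
  exists ((pfs P (B c v))^-1 *: v); split; first by rewrite scalemx_sub ?row_sub.
  by rewrite pfBZr fmorphV pfsK mulVf.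
have [qd Bdd] := vert_psing dz dz.
have Bz u v : (u <= val z)%MS -> (v <= val z)%MS -> B u v = 0.
  by move=> uz vz; have [] := vert_psing uz vz.
pose e1 i := e i + (- B (e i) d) *: c; pose f1 i := f i + a (f i) *: c.
have f1z i : (i < l)%N -> (f1 i <= val z)%MS.
  by move=> ltil; apply: az; rewrite yE (submx_trans _ (addsmxSl _ _)) ?mem_span.
have efc i : (i < l)%N -> B (e i) c = 0 /\ B (f i) c = 0.
  move=> ltil; have [/rV_subP/(_ c cE)/perpmxP ce /rV_subP/(_ c cE)/perpmxP cf] := Eef i ltil.
  by split; apply: pfB0C.
have fr1 : hyp_frame P l l e1 f1.
  by apply: (hyp_frame_shift _ _ fr) => // i /efc[].
pose e2 i := if i == l then c else e1 i; pose f2 i := if i == l then d else f1 i.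
have fr2 : hyp_frame P l.+1 l.+1 e2 f2.
  apply: (hyp_frame_rcons fr1 qc qd Bcd) => i ltil; have [ec fc] := efc i ltil.
  split; last exact/Bz/dz/f1z.
  - by rewrite /e1 !pfBE ec Bcc mulr0 addr0.
  - by rewrite /f1 !pfBE fc Bcc mulr0 addr0.
  by rewrite /e1 !pfBE Bcd mulr1 addrN.
pose E2 := (E :&: val z)%MS.
have EE2 : (E <= E2 + c)%MS.
  apply/rV_subP => u uE; rewrite -[u](addrK (a u *: c)).
  have ucz : ((u + a u *: c)%R <= val z)%MS.
    by apply: az; rewrite yE (submx_trans uE) ?addsmxSr.
  apply: addmx_sub; last by rewrite -scaleNr scalemx_sub ?addsmxSr.
  apply: submx_trans (addsmxSl _ _); rewrite sub_capmx ucz andbT.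
  by rewrite addmx_sub ?scalemx_sub.
have cE2 : ~~ (c <= E2)%MS by rewrite sub_capmx negb_and cz orbT.
have rE2 : (\rank E = (\rank E2).+1)%N.
  rewrite -(rank_adds_vec cE2); apply/eqP; rewrite eqn_leq (mxrankS EE2) mxrankS //.
  by rewrite addsmx_sub capmxSl.
exists e2, f2, E2; split=> //.
- exact: psingS (capmxSl _ _) sE.
- by rewrite addSnnS -rE2.
- move=> i; rewrite ltnS leq_eqVlt /e2 /f2 => lti.
  split; apply/rV_subP => u; rewrite sub_capmx => /andP[uE uz]; apply/perpmxP.
    case: eqP lti => [_ _|_ /= ltil]; first exact: BcE.
    have [/rV_subP/(_ u uE)/perpmxP ue _] := Eef i ltil.
    by rewrite /e1 !pfBE ue BcE // mulr0 addr0.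
  case: eqP lti => [_ _|_ /= ltil]; first exact: Bz.
  exact/Bz/f1z.
have e2l : e2 l = c by rewrite /e2 eqxx.
have f2l : f2 l = d by rewrite /f2 eqxx.
have e2E j : (j < l)%N -> e2 j = e1 j by move=> ltj; rewrite /e2 ltn_eqF.
have f2E j : (j < l)%N -> f2 j = f1 j by move=> ltj; rewrite /f2 ltn_eqF.
move=> i; rewrite leq_eqVlt ltnS => /predU1P[->|leil]; last first.
  rewrite nthp //; apply: eqmx_trans (spanE i leil) _; apply/eqmxP.
  (* Index [l] is not yet swapped when [i <= l], so [c] is itself one of the new spanning vectors
     and absorbs the added multiples. *)
  have c2 : (c <= span l.+1 (swap_below i e2 f2))%MS.
    have <- : swap_below i e2 f2 l = c by rewrite /swap_below ltnNge leil.
    exact: mem_span.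
  apply/andP; split; rewrite addsmx_sub; apply/andP; split.
  - apply/span_subP => j ltjl.
    have : (swap_below i e2 f2 j <= span l.+1 (swap_below i e2 f2))%MS.
      exact/mem_span/ltnW.
    rewrite {1}/swap_below e2E // f2E // /e1 /f1 => j2.
    apply: submx_trans (addsmxSl _ _); rewrite /swap_below.
    by case: ifP j2 => _ /addmx_sub/(_ (scalemx_sub _ c2)) H;
      [have := H (- a (f j)) | have := H (B (e j) d)];
      rewrite scaleNr ?addrK ?addrNK.
  - apply: submx_trans EE2 _; rewrite addsmx_sub addsmxSr.
    exact: submx_trans c2 (addsmxSl _ _).
  - apply/span_subP => j; rewrite ltnS leq_eqVlt => /predU1P[->|ltjl].
      rewrite /swap_below ltnNge leil /= e2l.
      exact: submx_trans cE (addsmxSr _ _).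
    have : (swap_below i e f j <= span l (swap_below i e f))%MS by apply: mem_span.
    rewrite {1 3}/swap_below e2E // f2E // /e1 /f1 => j2.
    have cS : (c <= span l (swap_below i e f) + E)%MS.
      exact: submx_trans cE (addsmxSr _ _).
    by case: ifP j2 => _ j2; rewrite addmx_sub ?scalemx_sub //;
      apply: submx_trans j2 (addsmxSl _ _).
  exact: submx_trans (capmxSl _ _) (addsmxSr _ _).
rewrite nthz (@eq_span _ _ l.+1 _ f2); last first.
  by move=> j ltj; rewrite /swap_below ltj.
have f2z j : (j < l.+1)%N -> (f2 j <= val z)%MS.
  by rewrite ltnS leq_eqVlt => /predU1P[->|ltj]; rewrite ?f2l // f2E // f1z.
apply: eqmx_sym; apply: eqmx_of_rank.
  by rewrite addsmx_sub capmxSr andbT; apply/span_subP.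
(* Rank count for [z]: [R + c] contains [y], so [R] has rank at least [k - 1]; [R] is perpendicular
   to [c] and [d] is not, so [R + d] has rank at least [k]. *)
pose R := (span l f1 + E2)%MS.
have Rc : (R <= perp c)%MS.
  rewrite addsmx_sub; apply/andP; split.
    apply/span_subP => j ltj; apply/perpmxP; have [_ fc] := efc j ltj.
    by rewrite !pfBE fc Bcc mulr0 addr0.
  apply/rV_subP => u; rewrite sub_capmx => /andP[uE _].
  exact/perpmxP/BcE.
have dR : ~~ (d <= R)%MS.
  apply/negP => /submx_trans/(_ Rc)/perpmxP/pfB0C/eqP.
  by rewrite Bcd oner_eq0.
have yR : (val y <= R + c)%MS.
  rewrite yE addsmx_sub; apply/andP; split; last first.
    by apply: submx_trans EE2 _; rewrite addsmxS ?addsmxSr.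
  apply/span_subP => j ltj; rewrite -[f j](addrK (a (f j) *: c)).
  apply: addmx_sub; last by rewrite -scaleNr scalemx_sub ?addsmxSr.
  apply: submx_trans (addsmxSl _ _); apply: submx_trans (addsmxSl _ _).
  exact: mem_span ltj.
have rR : (k <= (\rank R).+1)%N.
  rewrite -[X in (X <= _)%N](vert_rank y); apply: leq_trans (mxrankS yR) _.
  apply: leq_trans (mxrank_adds_leqif _ _) _.
  by apply: leq_trans (leq_add (leqnn _) (rank_leq_row c)) _; rewrite addn1.
rewrite vert_rank; apply: leq_trans rR _; rewrite -(rank_adds_vec dR).
apply: mxrankS; rewrite !addsmx_sub addsmxSr andbT -f2l.
rewrite [X in _ && X](submx_trans _ (addsmxSl _ _)) ?mem_span // andbT.
apply: submx_trans (addsmxSl _ _); apply/span_subP => j ltj.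
by rewrite -f2E //; apply/mem_span/ltnW.
Qed.

Lemma geodesic_max_frame x p : geodesic adj x p -> exists e f,
  hyp_frame P k k e f /\ forall i, (i <= size p)%N ->
    (val (nth x (x :: p) i) :=: span k (swap_below i e f))%MS.
Proof.
move=> /geodesic_max[e [f [E [fr sE rE Eef spanE]]]].
move: (size p) fr rE Eef spanE => l fr rE Eef spanE.
have lek : (l <= k)%N by rewrite -rE leq_addr.
have [b bE] := span_basis E.
pose e' j := if (j < l)%N then e j else b (j - l)%N.
have span_split i f' : (i <= l)%N -> (forall j, (j < l)%N -> f' j = f j) ->
    (span l (swap_below i e f) + E :=: span k (swap_below i e' f'))%MS.
  move=> leil ff'; apply/eqmxP/andP; split.
    rewrite addsmx_sub -bE; apply/andP; split; apply/span_subP => j ltj.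
      have -> : swap_below i e f j = swap_below i e' f' j.
        by rewrite /swap_below /e' ltj ff'.
      exact/mem_span/(leq_trans ltj).
    have -> : b j = swap_below i e' f' (l + j).
      by rewrite /swap_below /e' !ltnNge leq_addr (leq_trans leil) ?leq_addr //= addKn.
    by apply: mem_span; rewrite -rE ltn_add2l.
  apply/span_subP => j ltjk; have [ltjl|lelj] := ltnP j l.
    apply: submx_trans (addsmxSl _ _).
    have -> : swap_below i e' f' j = swap_below i e f j.
      by rewrite /swap_below /e' ltjl ff'.
    exact: mem_span.
  apply: submx_trans (addsmxSr _ _); rewrite -bE.
  rewrite /swap_below /e' !ltnNge lelj (leq_trans leil lelj) /=.
  by apply: mem_span; rewrite ltn_subLR // rE.
have x_e' : (val x :=: span k e')%MS.
  exact: eqmx_trans (spanE 0%N isT) (span_split 0%N f isT (fun _ _ => erefl)).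
have qe' i : (i < k)%N -> (e' i <= val x)%MS.
  by rewrite x_e'; apply: mem_span.
have fr' : hyp_frame P k l e' f.
  split=> [i lti|i lti|i j lti ltj|i j lti ltj|i j lti ltj].
  - by have [] := vert_psing (qe' i lti) (qe' i lti).
  - exact: (hf_qf fr).
  - by have [] := vert_psing (qe' i lti) (qe' j ltj).
  - exact: (hf_ff fr).
  rewrite /e'; case: (ltnP i l) => [ltil|leli]; first exact: (hf_ef fr).
  rewrite gtn_eqF ?(leq_trans ltj) //; apply/perpmxP; have [_ Ef] := Eef j ltj.
  apply: submx_trans Ef; rewrite -bE; apply: mem_span.
  by rewrite ltn_subLR // rE.
have free_e' : row_free (span k e').
  by rewrite /row_free -x_e' vert_rank.
have [f' [fr2 ff']] := hyp_frame_complete lek free_e' fr'.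
exists e', f'; split=> // i lei.
exact: eqmx_trans (spanE i lei) (span_split i f' lei ff').
Qed.

Lemma geodesic_transitive_max : geodesic_transitive adj.
Proof.
move=> x y p r spr /geodesic_max_frame[e [f [fr pE]]].
move=> /geodesic_max_frame[e' [f' [fr' rE]]].
have [g [isog gef]] := hyp_frame_conj fr fr'.
apply: (geodesic_conj isog) => // i lei.
apply: eqmx_trans (eqmxMr _ (pE i lei)) _; rewrite span_mul.
rewrite spr in lei; apply: eqmx_trans _ (eqmx_sym (rE i lei)).
rewrite (@eq_span _ _ k _ (swap_below i e' f')) //.
by move=> j ltj; rewrite /swap_below; have [ej fj] := gef j ltj; case: ifP.
Qed.

End MaximalSubspaces.

Section NonMaximalSubspaces.
Hypothesis k_lt : (k < omega)%N.

Lemma adj_nonmax x y : reflect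
  [/\ x != y, psing (val x + val y)%MS & \rank (val x + val y)%MS = k.+1] (adj x y).
Proof.
have -> : adj x y = [&& val x != val y, fs_singular W (val x + val y)%MS
                      & \rank (val x + val y)%MS == k.+1].
  by rewrite /polar_adj ltn_eqF.
rewrite (inj_eq val_inj); apply: (iffP and3P) => -[nxy sxy rxy].
  by split=> //; [apply/singW | apply/eqP].
by split=> //; [apply/singW | apply/eqP].
Qed.

Lemma adj_sup m (U : 'M_(m, n)) x y : psing U -> \rank U = k.+1 -> x != y ->
  (val x <= U)%MS -> (val y <= U)%MS -> adj x y.
Proof.
move=> sU rU nxy xU yU; have xyU : (val x + val y <= U)%MS by rewrite addsmx_sub xU.
apply/adj_nonmax; split=> //; first exact: psingS sU.
apply/eqP; rewrite eqn_leq -{1}rU mxrankS //=.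
rewrite -[X in (X < _)%N](vert_rank x) ltn_neqAle mxrankS ?addsmxSl // andbT.
rewrite (mxrank_leqif_sup (addsmxSl _ _)) addsmx_sub submx_refl /=.
by apply: contra nxy => /vert_sub_eq ->.
Qed.

Lemma adj_perp x y u v : adj x y -> (u <= val x)%MS -> (v <= val y)%MS -> B u v = 0.
Proof.
move=> /adj_nonmax[_ sxy _] ux vy.
by have [] := sxy u v (submx_trans ux (addsmxSl _ _)) (submx_trans vy (addsmxSr _ _)).
Qed.

(** * The polar graph *)

Section Points.
Hypothesis k1 : k = 1%N.

Lemma point_vec x : exists v, [/\ (val x :=: v)%MS, v != 0 & q v = 0].
Proof.
pose v := nz_row (val x); have vx : (v <= val x)%MS := nz_row_sub _.
have v0 : v != 0 by rewrite nz_row_eq0 -mxrank_eq0 vert_rank k1.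
exists v; split=> //; last by have [] := vert_psing vx vx.
by apply/eqmx_sym/eqmx_of_rank; rewrite // vert_rank rank_rV v0 k1.
Qed.

Lemma adj_points x y u v : (val x :=: u)%MS -> (val y :=: v)%MS ->
  x != y -> B u v = 0 -> adj x y.
Proof.
move=> xu yv nxy Buv; apply/adj_nonmax; split=> //.
  apply: psing_adds; [exact: (@vert_psing x) | exact: (@vert_psing y)|].
  move=> a b; rewrite xu yv => /sub_rVP[c ->] /sub_rVP[d ->].
  by rewrite !pfBE Buv !mulr0.
have nvx : ~~ (v <= val x)%MS.
  by rewrite -yv; apply: contra nxy => /vert_sub_eq ->.
by rewrite (adds_eqmx (eqmx_refl (val x)) yv) rank_adds_vec // vert_rank.
Qed.

(* A second pair exists in a maximal frame; conjugate it to the given one. *)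
Lemma perp_vec e f : hyp_frame P 1 1 e f ->
  exists u, [/\ u != 0, q u = 0, B u (e 0%N) = 0 & B u (f 0%N) = 0].
Proof.
move=> fr; have [e' [f' fr']] := witt_frame.
have lt1 : (1 < omega)%N by rewrite -{1}k1.
have le1 := ltnW lt1.
have [g [isog gef]] := hyp_frame_conj (hyp_frame_sub le1 le1 fr') fr.
have [<- <-] := gef 0%N isT; have [Bg qg] := isog; exists (e' 1%N *m g).
rewrite qg !Bg (hf_qe fr') // (hf_ee fr') // (hf_ef fr') //; split=> //.
rewrite mulmx_free_eq0 ?row_free_unit ?(isometry_unit isog) //.
apply/eqP => e0; have := hf_ef fr' lt1 lt1.
by rewrite e0 pfB0l => /esym/eqP; rewrite eqxx oner_eq0.
Qed.

Lemma normalize_vec u v : q v = 0 -> B u v != 0 ->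
  exists w, [/\ (v :=: w)%MS, q w = 0 & B u w = 1].
Proof.
move=> qv Buv; exists ((pfs P (B u v))^-1 *: v).
split; last by rewrite pfBZr fmorphV pfsK mulVf.
  by apply/eqmx_sym/eqmx_scale; rewrite invr_eq0 fmorph_eq0.
by rewrite pfqZ qv mulr0.
Qed.

Lemma hyp_frame11 u v : q u = 0 -> q v = 0 -> B u v = 1 ->
  hyp_frame P 1 1 (fun=> u) (fun=> v).
Proof.
by move=> qu qv Buv; split=> // [||[] // [] //] *; apply: pfq_iso.
Qed.

(** Two non-perpendicular points form a hyperbolic pair after scaling; a singular vector
    perpendicular to that pair is a common neighbour. *)
Lemma walkb_points x y : exists2 j, (j <= 2)%N & walkb adj x y j.
Proof.
have [->|nxy] := eqVneq x y; first by exists 0%N; rewrite ?walkb0.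
have [u [xu u0 qu]] := point_vec x; have [v [yv v0 qv]] := point_vec y.
have [Buv|nBuv] := eqVneq (B u v) 0.
  by exists 1%N; [|rewrite walkb1; apply: adj_points Buv].
have [w [vw qw Buw]] := normalize_vec qv nBuv.
have [t [t0 qt Btu Btw]] := perp_vec (hyp_frame11 qu qw Buw).
have [|z zt] := vert_exists (psing_vec qt); first by rewrite rank_rV t0 k1.
have yw : (val y :=: w)%MS := eqmx_trans yv vw.
have nxz : x != z.
  apply/eqP => xz; have : (u <= t)%MS by rewrite -zt -xz xu.
  case/sub_rVP=> c uE; move: Buw; rewrite uE pfBZl Btw mulr0 => /esym/eqP.
  by rewrite oner_eq0.
have nzy : z != y.
  apply/eqP => zy; have : (w <= t)%MS by rewrite -zt zy yw.
  case/sub_rVP=> c wE; move: Buw; rewrite wE pfBZr (pfB0C Btu) mulr0 => /esym/eqP.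
  by rewrite oner_eq0.
exists 2%N => //; apply: (@walkb_cons _ _ _ z); last rewrite walkb1.
  exact: adj_points xu zt nxz (pfB0C Btu).
exact: adj_points zt yw nzy Btw.
Qed.

Lemma connected_points : graph_connected adj.
Proof. by move=> x y; have [j _ w] := walkb_points x y; exists j. Qed.

Lemma row_free_pair (u v : 'rV[F]_n) : u != 0 -> ~~ (v <= u)%MS -> row_free (span 2 (nth 0 [:: u; v])).
Proof.
move=> u0 nvu; have uvE : (span 2 (nth 0 [:: u; v]) :=: u + v)%MS.
  apply/eqmxP/andP; split; last first.
    rewrite addsmx_sub; apply/andP; split.
      exact: (@mem_span _ _ 2 (nth 0 [:: u; v]) 0).
    exact: (@mem_span _ _ 2 (nth 0 [:: u; v]) 1).
  by apply/span_subP => -[|[|]] // _; rewrite ?addsmxSl ?addsmxSr.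
by rewrite /row_free uvE rank_adds_vec // rank_rV u0.
Qed.

Lemma hyp_frame_pair u v l f : q u = 0 -> q v = 0 -> B u v = 0 ->
  (forall i, (i < l)%N -> [/\ q (f i) = 0, B u (f i) = (i == 0)%:R & B v (f i) = (i == 1)%:R]) ->
  (l <= 1)%N -> hyp_frame P 2 l (nth 0 [:: u; v]) f.
Proof.
move=> qu qv Buv fl lel.
have Bvu := pfB0C Buv.
split=> [i lti|i lti|i j lti ltj|i j lti ltj|i j lti ltj].
- by case: i lti => [|[|]].
- by have [] := fl i lti.
- by case: i j lti ltj => [|[|]] // [|[|]] // _ _; apply: pfq_iso.
- have eq0 m : (m < l)%N -> m = 0%N.
    by move=> /leq_trans/(_ lel); case: m => [|[]].
  by rewrite (eq0 i lti) (eq0 j ltj); apply: pfq_iso; have [] := fl i lti; rewrite (eq0 i).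
have [_ Bu Bv] := fl j ltj.
by case: i lti => [|[|]] //= _; rewrite ?Bu ?Bv eq_sym.
Qed.

(** Two full pairs are produced even for shorter geodesics, so that one conjugation of frames serves
    every length. *)
Lemma geodesic_points_frame x p : geodesic adj x p -> exists e f,
  hyp_frame P 2 2 e f /\ forall i, (i <= size p)%N ->
    (val (nth x (x :: p) i) :=: nth 0%R [:: e 0%N; e 1%N; f 0%N] i)%MS.
Proof.
have [u [xu u0 qu]] := point_vec x.
have frame2 v l f : q v = 0 -> B u v = 0 -> ~~ (v <= u)%MS -> (l <= 1)%N ->
    (forall i, (i < l)%N -> [/\ q (f i) = 0, B u (f i) = (i == 0)%:R
                              & B v (f i) = (i == 1)%:R]) ->
    exists e f', [/\ hyp_frame P 2 2 e f', e 0%N = u, e 1%N = v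
                   & forall i, (i < l)%N -> f' i = f i].
  move=> qv Buv nvu lel fl.
  have [|f' [fr' ff']] := hyp_frame_complete _ (row_free_pair u0 nvu)
    (hyp_frame_pair qu qv Buv fl lel); first exact: leq_trans lel _.
  by exists (nth 0 [:: u; v]), f'.
have adj_vec y v : adj x y -> (val y :=: v)%MS -> B u v = 0 /\ ~~ (v <= u)%MS.
  move=> axy yv; split; first by apply: (adj_perp axy); rewrite ?xu ?yv.
  rewrite -xu -yv; have /adj_nonmax[nxy _ _] := axy.
  by apply: contra nxy => /vert_sub_eq ->.
case: p => [_|y p].
  have free_u : row_free (span 1 (fun=> u)).
    by rewrite (_ : span 1 _ = u) /row_free ?rank_rV ?u0 //;
       apply/row_matrixP => i; rewrite rowK !ord1 row_id.
  have fr0 : hyp_frame P 1 0 (fun=> u) (fun=> 0).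
    by split=> // *; apply: pfq_iso.
  have [//|f [fr _]] := hyp_frame_complete _ free_u fr0.
  (* One point accounts for one pair only; [v] starts the second. *)
  have [v [v0 qv Bvu Bvf]] := perp_vec fr.
  have nvu : ~~ (v <= u)%MS.
    have Buf : B u (f 0%N) = 1 := hf_ef fr (ltn0Sn 0) (ltn0Sn 0).
    apply/negP => /sub_rVP[c vE]; move: Bvf v0.
    by rewrite vE pfBZl Buf mulr1 => ->; rewrite scale0r eqxx.
  have [//|//|e [f' [fr' eu _ _]]] := @frame2 v 0%N (fun=> 0) qv (pfB0C Bvu) nvu.
  by exists e, f'; split=> // -[] // _; rewrite /= eu.
have [v [yv v0 qv]] := point_vec y.
case: p => [|z p] geo.
  have axy : adj x y by move: geo => /andP[/andP[]].
  have [Buv nvu] := adj_vec y v axy yv.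
  have [//|//|e [f' [fr' eu ev _]]] := @frame2 v 0%N (fun=> 0) qv Buv nvu.
  by exists e, f'; split=> // -[|[]] // _; rewrite /= ?eu ?ev.
case: p geo => [|t p] geo; last first.
  (* Three or more edges contradict the bound 2 on distances. *)
  move: geo => /andP[_ /distbP[_ nw]].
  have [j lej w] := walkb_points x (last x [:: y, z, t & p]).
  have ltj : (j < size [:: y, z, t & p])%N by apply: leq_ltn_trans lej _.
  by have := nw j ltj; rewrite w.
move: geo => /andP[/and3P[axy ayz _] /distbP[_ nw]].
have [Buv nvu] := adj_vec y v axy yv.
have [w [zw w0 qw]] := point_vec z.
have nBuw : B u w != 0.
  apply/eqP => Buw; have := nw 1%N isT; have := nw 0%N isT.
  rewrite walkb0 walkb1 /= => nxz /negP[].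
  exact: adj_points xu zw nxz Buw.
have [w1 [ww1 qw1 Buw1]] := normalize_vec qw nBuw.
have zw1 : (val z :=: w1)%MS := eqmx_trans zw ww1.
have Bvw1 : B v w1 = 0 by apply: (adj_perp ayz); rewrite ?yv ?zw1.
have [//||e [f' [fr' eu ev ff']]] := @frame2 v 1%N (fun=> w1) qv Buv nvu.
  by case=> // _; rewrite qw1 Buw1 Bvw1.
by exists e, f'; split=> // -[|[|[]]] // _; rewrite /= ?eu ?ev ?ff'.
Qed.

Lemma geodesic_transitive_points : geodesic_transitive adj.
Proof.
move=> x y p r spr gp gr.
have [e [f [fr pE]]] := geodesic_points_frame gp.
have [e' [f' [fr' rE]]] := geodesic_points_frame gr.
have [g [isog gef]] := hyp_frame_conj fr fr'.
apply: (geodesic_conj isog) => // i lei.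
apply: eqmx_trans (eqmxMr _ (pE i lei)) _.
rewrite spr in lei; apply: eqmx_trans _ (eqmx_sym (rE i lei)).
have [[g0 gf0] [g1 _]] := (gef 0%N isT, gef 1%N isT).
(* Beyond index 2 both sides are the default 0. *)
by case: i {lei} => [|[|[|i]]] /=; rewrite ?g0 ?g1 ?gf0 ?nth_nil ?mul0mx.
Qed.

End Points.

(** * Failure of regularity strictly between the two ends *)

Section Intermediate.
Variables (e f : nat -> 'rV[F]_n).
Hypothesis fr : hyp_frame P omega omega e f.
Local Notation fvec := (frame_vec e f).
Implicit Types (t : seq (bool * nat)) (r : bool * nat).

(** The vectors [e 0, ..., e (m - 1)] form a common base of the vertices under comparison; [t] lists
    what distinguishes them, with indices from [m] on as required by [above]. *)
Definition over_base t m := frame_span e f (t ++ [seq (false, i) | i <- iota 0 m]).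

Definition above m t := all (fun r => (m <= r.2 < omega)%N) t.

Lemma over_base_psing t m : above m t -> uniq (map snd t) -> (m <= omega)%N ->
  psing (over_base t m) /\ \rank (over_base t m) = (size t + m)%N.
Proof.
move=> /allP tm ut lem.
have [||sL rL] := @frame_span_psing _ _ _ _ _ _ fr (t ++ [seq (false, i) | i <- iota 0 m]).
- apply/allP => r; rewrite mem_cat => /orP[/tm/andP[] //|/mapP[i]].
  by rewrite mem_iota => /andP[_ ltim] ->; apply: leq_trans lem.
- rewrite map_cat -map_comp map_id cat_uniq ut iota_uniq andbT /=.
  apply/hasPn => i; rewrite mem_iota => /andP[_ ltim]; apply/negP => /mapP[r /tm].
  by move=> /andP[ler _] ir; move: ler; rewrite -ir leqNgt ltim.
by split=> //; rewrite rL size_cat size_map size_iota.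
Qed.

Lemma over_base_perp t m r : above m (r :: t) -> (m <= omega)%N ->
  all (fun r' => (r'.1 == r.1) || (r'.2 != r.2)) t ->
  (over_base t m <= perp (fvec r))%MS.
Proof.
move=> /= /andP[/andP[ler ltr] /allP tm] lem tr; apply: (frame_span_perp fr).
  rewrite /= ltr; apply/allP => r'; rewrite mem_cat => /orP[/tm/andP[] //|/mapP[i]].
  by rewrite mem_iota => /andP[_ ltim] ->; apply: leq_trans lem.
rewrite all_cat tr; apply/allP => r' /mapP[i]; rewrite mem_iota => /andP[_ ltim] -> /=.
by rewrite ltn_eqF ?orbT // (leq_trans ltim).
Qed.

Lemma over_base_exists t m : above m t -> uniq (map snd t) -> (m <= omega)%N ->
  (size t + m)%N = k -> exists x, (val x :=: over_base t m)%MS.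
Proof.
move=> tm ut lem tk; have [sL rL] := over_base_psing tm ut lem.
by apply: vert_exists; rewrite // rL.
Qed.

Lemma over_baseS t t' m m' : {subset t <= t'} -> (m <= m')%N ->
  (over_base t m <= over_base t' m')%MS.
Proof.
move=> tt' lem; apply: frame_spanS => r; rewrite !mem_cat => /orP[/tt' -> //|].
case/mapP=> i; rewrite mem_iota => /andP[_ ltim] ->; apply/orP; right.
by rewrite map_f // mem_iota /=; apply: leq_trans lem.
Qed.

Lemma over_base_adj x y t t' t'' m : (val x :=: over_base t m)%MS ->
  (val y :=: over_base t' m)%MS -> x != y -> above m t'' -> uniq (map snd t'') ->
  (m <= omega)%N -> (size t'' + m)%N = k.+1 ->
  all [in t''] t -> all [in t''] t' -> adj x y.
Proof.
move=> xt yt' nxy tm ut lem tk /allP tt'' /allP tt'.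
have [sU rU] := over_base_psing tm ut lem.
apply: (adj_sup sU _ nxy); first by rewrite rU.
  by rewrite xt over_baseS.
by rewrite yt' over_baseS.
Qed.

(** The vector named by [r'] separates the two: all of [y] is perpendicular to it, but its partner
    in [x] is not. *)
Lemma over_base_neq x y t t' m r r' : (val x :=: over_base t m)%MS ->
  (val y :=: over_base t' m)%MS -> r \in t -> above m (r' :: t') -> (m <= omega)%N ->
  all (fun r'' => (r''.1 == r'.1) || (r''.2 != r'.2)) t' ->
  r.1 != r'.1 -> r.2 = r'.2 -> x != y.
Proof.
move=> xt yt' rt tm lem tr' r1 r2; apply/eqP => xy.
have rx : (fvec r <= val x)%MS by rewrite xt mem_frame_span // mem_cat rt.
have := over_base_perp tm lem tr'; rewrite -yt' -xy => /(submx_trans rx)/perpmxP/eqP.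
apply/negP; apply: (frame_vec_B fr) => //; rewrite r2.
by move: tm => /= /andP[/andP[]].
Qed.

(** A hyperbolic pair shared out between [x] and [y] keeps their sum from being singular. *)
Lemma over_base_nonadj x y t t' m r r' : (val x :=: over_base t m)%MS ->
  (val y :=: over_base t' m)%MS -> r \in t -> r' \in t' -> (r.2 < omega)%N ->
  r.1 != r'.1 -> r.2 = r'.2 -> ~~ adj x y.
Proof.
move=> xt yt' rt rt' ltr r1 r2; apply/negP => axy.
have rx : (fvec r <= val x)%MS by rewrite xt mem_frame_span // mem_cat rt.
have ry : (fvec r' <= val y)%MS by rewrite yt' mem_frame_span // mem_cat rt'.
by have /eqP := adj_perp axy rx ry; apply/negP/(frame_vec_B fr).
Qed.

(* [x :&: z] and [x :&: perp v] both have rank [k.-1], so they agree. *)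
Lemma common_neighbour_contains m (U : 'M_(m, n)) x z v :
  adj x z -> (U <= val x)%MS -> (U <= perp v)%MS -> (k <= (\rank U).+1)%N ->
  (val z <= perp v)%MS -> ~~ (val x <= perp v)%MS -> (U <= val z)%MS.
Proof.
move=> /adj_nonmax[_ _ rxz] Ux Uv rU zv nxv.
have rcap : (\rank (val x :&: val z)%MS).+1 = k.
  have := mxrank_sum_cap (val x) (val z); rewrite rxz !vert_rank.
  by rewrite addSn -addnS => /addnI.
have sxz : (val x :&: val z <= val x :&: perp v)%MS.
  by rewrite sub_capmx capmxSl (submx_trans (capmxSr _ _)).
have rxv : (\rank (val x :&: perp v)%MS < k)%N.
  rewrite -[X in (_ < X)%N](vert_rank x) ltn_neqAle mxrankS ?capmxSl // andbT.
  rewrite (mxrank_leqif_sup (capmxSl _ _)).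
  by apply: contra nxv => sx; apply: submx_trans sx (capmxSr _ _).
have eqxz : (val x :&: val z :=: val x :&: perp v)%MS.
  apply: eqmx_of_rank sxz _; rewrite -ltnS rcap //.
apply: submx_trans (capmxSr (val x) _); rewrite eqxz.
by rewrite sub_capmx Ux.
Qed.

(** Here [v] is the partner, lying in [y], of the vector [(b, j)] of [x]. A common neighbour is
    perpendicular to [v], so it must contain the part of [x] perpendicular to [v], of which the base
    and [r] span all [k - 1] dimensions. *)
Lemma common_neighbour_base x y z t t' m r b j : k = m.+2 ->
  (val x :=: over_base t m)%MS -> (val y :=: over_base t' m)%MS ->
  adj x z -> adj y z -> r \in t -> (b, j) \in t -> (~~ b, j) \in t' ->
  r.2 != j -> (m <= r.2 < omega)%N -> (m <= j < omega)%N ->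
  (over_base [:: r] m <= val z)%MS.
Proof.
move=> km xE yE axz ayz rt bt bt' rj mr mj.
have /andP[lem ltj] := mj; have lemo : (m <= omega)%N by apply/ltnW/(leq_ltn_trans lem).
have abr : above m [:: r] by rewrite /above /= mr.
apply: (common_neighbour_contains (v := fvec (~~ b, j)) axz).
- by rewrite xE over_baseS // => r'; rewrite inE => /eqP ->.
- by apply: over_base_perp; rewrite /above //= ?mr ?mj //= rj orbT.
- by have [//|_ ->] := over_base_psing abr _ lemo; rewrite km.
- apply/rV_subP => u uz; apply/perpmxP/pfB0C; apply: adj_perp ayz _ uz.
  by rewrite yE mem_frame_span // mem_cat bt'.
apply/negP => /rV_subP/(_ (fvec (b, j))); rewrite xE mem_frame_span ?mem_cat ?bt //.
move=> /(_ isT)/perpmxP/eqP; apply/negP/(frame_vec_B fr) => //.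
by case: b {bt bt'}.
Qed.

Ltac frame_side := rewrite /above /= ?inE ?xpair_eqE /=; lia.

Lemma intermediate_not_constant : (1 < k)%N -> ~ constant_sphere_cards adj.
Proof.
move=> k_gt1 cst; have [K kK] : exists K, k = K.+2.
  by exists k.-2; case: k k_gt1 => [|[]].
have ltK : (K.+2 < omega)%N by rewrite -kK.
have [leK leK1] : (K <= omega)%N /\ (K.+1 <= omega)%N by split; lia.
(* First configuration: [A] is the base [e 0, ..., e K], the pair of index [K.+1] is [(e, f)], and
   the pair of index [K.+2], available because [k < omega], is [(e', f')]. *)
have [x1 x1E] : exists x, (val x :=: over_base [:: (false, K.+1)] K.+1)%MS.
  by apply: over_base_exists; frame_side.
have [y1 y1E] : exists x, (val x :=: over_base [:: (true, K.+1)] K.+1)%MS.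
  by apply: over_base_exists; frame_side.
have ex_z1 b : exists x, (val x :=: over_base [:: (b, K.+2)] K.+1)%MS.
  by apply: over_base_exists; frame_side.
have [[z1 z1E] [w1 w1E]] := (ex_z1 false, ex_z1 true).
have adj1 b c x z : (val x :=: over_base [:: (b, K.+1)] K.+1)%MS ->
    (val z :=: over_base [:: (c, K.+2)] K.+1)%MS -> adj x z /\ adj z x.
  move=> xE zE; have nxz : x != z.
    by apply: (@over_base_neq _ _ _ _ _ (b, K.+1) (~~ b, K.+1) xE zE) => //;
       case: b c {xE zE} => [] []; frame_side.
  have nzx : z != x by rewrite eq_sym.
  split; [apply: (@over_base_adj _ _ _ _ [:: (b, K.+1); (c, K.+2)] _ xE zE nxz)
         |apply: (@over_base_adj _ _ _ _ [:: (b, K.+1); (c, K.+2)] _ zE xE nzx)];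
    by case: b c {xE zE} => [] []; frame_side.
have dist1 : distb adj x1 y1 2.
  apply: distb2 (adj1 _ _ _ _ x1E z1E).1 (adj1 _ _ _ _ y1E z1E).2.
    by apply: (@over_base_neq _ _ _ _ _ (false, K.+1) (true, K.+1) x1E y1E);
       frame_side.
  by apply: (@over_base_nonadj _ _ _ _ _ (false, K.+1) (true, K.+1) x1E y1E);
     frame_side.
have card1 : (1 < sphere_card adj x1 y1 1)%N.
  have nzw : z1 != w1.
    by apply: (@over_base_neq _ _ _ _ _ (false, K.+2) (true, K.+2) z1E w1E);
       frame_side.
  have mem1 b z : (val z :=: over_base [:: (b, K.+2)] K.+1)%MS ->
      adj x1 z && distb adj y1 z 1.
    move=> zE; rewrite distb1 (adj1 _ _ _ _ x1E zE).1.
    have [ayz _] := adj1 _ _ _ _ y1E zE; rewrite ayz andbT.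
    by have /adj_nonmax[] := ayz.
  apply: (@leq_trans #|[set z1; w1]|); first by rewrite cards2 nzw.
  apply/subset_leq_card/subsetP => z; rewrite !inE => /orP[] /eqP ->.
    exact: mem1 z1E.
  exact: mem1 w1E.
(* Second configuration: [A] is [e 0, ..., e (K - 1)], with [e K] as [a], [e K.+2] as [b] and the
   pair of index [K.+1] as [(e, f)]. *)
have [x2 x2E] : exists x, (val x :=: over_base [:: (false, K); (false, K.+1)] K)%MS.
  by apply: over_base_exists; frame_side.
have [y2 y2E] : exists x, (val x :=: over_base [:: (false, K.+2); (true, K.+1)] K)%MS.
  by apply: over_base_exists; frame_side.
have [z2 z2E] : exists x, (val x :=: over_base [:: (false, K); (false, K.+2)] K)%MS.
  by apply: over_base_exists; frame_side.
have nxz2 : x2 != z2.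
  by apply: (@over_base_neq _ _ _ _ _ (false, K.+1) (true, K.+1) x2E z2E);
     frame_side.
have nyz2 : y2 != z2.
  by apply: (@over_base_neq _ _ _ _ _ (true, K.+1) (false, K.+1) y2E z2E);
     frame_side.
have axz2 : adj x2 z2.
  apply: (@over_base_adj _ _ _ _ [:: (false, K); (false, K.+1); (false, K.+2)] _ x2E z2E nxz2);
    frame_side.
have azy2 : adj z2 y2.
  rewrite eq_sym in nyz2.
  apply: (@over_base_adj _ _ _ _ [:: (false, K); (true, K.+1); (false, K.+2)] _ z2E y2E nyz2);
    frame_side.
have dist2 : distb adj x2 y2 2.
  apply: distb2 axz2 azy2.
    by apply: (@over_base_neq _ _ _ _ _ (false, K.+1) (true, K.+1) x2E y2E);
       frame_side.
  by apply: (@over_base_nonadj _ _ _ _ _ (false, K.+1) (true, K.+1) x2E y2E);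
     frame_side.
(* Two values of the same number [c_2] are compared: at least 2 and at most 1. *)
have := cst _ _ _ _ _ 1%N dist1 dist2 (or_intror (conj isT erefl)).
apply/eqP; rewrite gtn_eqF //; apply: leq_ltn_trans card1.
apply: (@leq_trans #|[set z2]|); last by rewrite cards1.
apply/subset_leq_card/subsetP => z.
rewrite !inE distb1 => /and3P[axz _ ayz]; rewrite eq_sym; apply/eqP/vert_sub_eq.
(* Seen from [x2], the vertex [z] contains the base and [e K]; seen from [y2], it contains [e K.+2].
   Together these span [z2]. *)
have zK : (over_base [:: (false, K)] K <= val z)%MS.
  by apply: (common_neighbour_base kK x2E y2E axz ayz (b := false) (j := K.+1));
     clear -ltK; frame_side.
have zK2 : (over_base [:: (false, K.+2)] K <= val z)%MS.
  by apply: (common_neighbour_base kK y2E x2E ayz axz (b := true) (j := K.+1));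
     clear -ltK; frame_side.
rewrite z2E; apply/frame_span_subP => r; rewrite mem_cat.
case/orP=> [|rK]; last first.
  by apply: submx_trans zK; rewrite mem_frame_span // mem_cat rK orbT.
rewrite !inE => /orP[] /eqP ->; [apply: submx_trans zK | apply: submx_trans zK2];
  by rewrite mem_frame_span // mem_cat mem_head.
Qed.

End Intermediate.

End NonMaximalSubspaces.
End PolarGrassmann.

Theorem theorem1p3 (F : finFieldType) (n : nat) (W : formed_space F n) (k : nat) :
  formed_nondegenerate W ->
  2 <= witt_index W ->
  1 <= k <= witt_index W ->
  (geodesic_transitive (polar_adj W k) <-> distance_regular (polar_adj W k)) /\
  (distance_regular (polar_adj W k) <-> (k = 1 \/ k = witt_index W)).
Proof.
move=> nondegW w_gt1 /andP[k_gt0 k_le].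
have [P singW] := formed_space_polar_form nondegW.
have [e [f fr]] := witt_frame singW.
have const_ends : constant_sphere_cards (polar_adj W k) -> k = 1 \/ k = witt_index W.
  move=> cst; have [|k_ne] := eqVneq k (witt_index W); first by right.
  have [|k_ne1] := eqVneq k 1; first by left.
  have k_lt : k < witt_index W by rewrite ltn_neqAle k_ne.
  have k_gt1 : 1 < k by rewrite ltn_neqAle eq_sym k_ne1.
  by case: (intermediate_not_constant singW k_lt fr k_gt1 cst).
(* Connectedness is recorded separately: it is part of distance-regularity but does not follow from
   transitivity on geodesics. *)
have ends : k = 1 \/ k = witt_index W ->
    geodesic_transitive (polar_adj W k) /\ graph_connected (polar_adj W k).
  case=> [k1|k_max]; last first.
    by split; [apply: geodesic_transitive_max k_max | apply: connected_max k_max].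
  have k_lt : k < witt_index W by rewrite k1.
  by split; [apply: geodesic_transitive_points k_lt k1
            |apply: connected_points k_lt k1].
have ends_regular : k = 1 \/ k = witt_index W -> distance_regular (polar_adj W k).
  move=> /ends[gt conn]; apply: constant_distance_regular conn _.
  exact: geodesic_transitive_constant.
split; split=> [gt|dr].
- exact/ends_regular/const_ends/geodesic_transitive_constant.
- by have [] := ends (const_ends (distance_regular_constant dr)).
- exact/const_ends/distance_regular_constant.
- exact: ends_regular.
Qed.
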